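(* Let $\rho>0$ and let $u:\Delta_\rho\to\mathbb{R}$ be a harmonic function on the finite open sector $$\Delta_\rho:=\{z\in\mathbb{C}:0<\arg z<\tfrac{\pi}{2},\ |z|<\rho\}.$$ Assume that: (1) $u$ has a continuous extension to $\overline{\Delta_\rho}\setminus\{0\}$ (also denoted by $u$); (2) there exist $l\in[0,2)$ and $\theta\in(0,\frac{\pi}{2})$ such that $\frac{\theta}{\pi}\notin\mathbb{Q}$ and $$\sup\Big\{|z|^l\,|u(z)|:\ z\in\overline{\Delta_\rho}\setminus\{0\},\ \arg z\in\{0,\theta,\tfrac{\pi}{2}\}\Big\}<\infty;$$ (3) there exists $m\in[0,\infty)$ such that $$\sup_{z\in\Delta_\rho}|\mathrm{Im}\,z|^m\,|u(z)|<\infty.$$ Then $$\sup_{z\in\Delta_\rho}|z|^l\,|u(z)|<\infty.$$ *)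

(* Defs.v *)
From Stdlib Require Import Reals Lra QArith Qreals.
From Coquelicot Require Import Coquelicot.
Open Scope R_scope.

(* Principal argument, with values in (-PI, PI]; its value at 0 is junk. *)
Definition Carg (z : C) : R :=
  if Rle_dec 0 (Im z) then acos (Re z / Cmod z) else - acos (Re z / Cmod z).

Lemma Carg_spec (z : C) : z <> 0%C ->
  - PI < Carg z <= PI /\
  z = (Cmod z * cos (Carg z), Cmod z * sin (Carg z))%R.
Proof.
intros Hz.
assert (Hm : 0 < Cmod z) by now apply Cmod_gt_0.
assert (Hsq : Cmod z ^ 2 = Re z ^ 2 + Im z ^ 2).
{ unfold Cmod. rewrite <- Rsqr_pow2, Rsqr_sqrt; [reflexivity|nra]. }
set (c := Re z / Cmod z).
assert (Hc : Re z = Cmod z * c) by (unfold c; field; lra).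
assert (Hs : Im z ^ 2 = Cmod z ^ 2 * (1 - c ^ 2)) by (rewrite Hc in Hsq; nra).
assert (Hc1 : c ^ 2 <= 1).
{ apply Rnot_lt_le; intros H.
  assert (0 < Cmod z ^ 2) by nra.
  assert (Cmod z ^ 2 * (c ^ 2 - 1) > 0) by (apply Rmult_gt_0_compat; lra).
  assert (0 <= Im z ^ 2) by nra. nra. }
assert (Hcb : -1 <= c <= 1) by nra.
pose proof (acos_bound c) as Hb.
pose proof (sin_acos c Hcb) as Hsin.
pose proof (cos_acos c Hcb) as Hcos.
assert (Habs : Cmod z * sin (acos c) = Rabs (Im z)).
{ rewrite Hsin, <- (sqrt_Rsqr_abs (Im z)), (Rsqr_pow2 (Im z)), Hs.
  rewrite sqrt_mult; [|nra|nra].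
  rewrite <- (Rsqr_pow2 (Cmod z)), sqrt_Rsqr by lra. now rewrite Rsqr_pow2. }
unfold Carg; fold c.
destruct (Rle_dec 0 (Im z)) as [Hi|Hi].
- split; [pose proof PI_RGT_0; lra|].
  rewrite Hcos, Habs, Rabs_right by lra.
  rewrite <- Hc. now destruct z.
- assert (Hpi : acos c <> PI).
  { intros E. rewrite E, sin_PI, Rmult_0_r in Habs.
    symmetry in Habs. revert Habs. apply Rabs_no_R0. lra. }
  split; [lra|].
  rewrite cos_neg, sin_neg, Hcos, Ropp_mult_distr_r_reverse, Habs, Rabs_left by lra.
  rewrite Ropp_involutive, <- Hc. now destruct z.
Qed.

Definition sector (rho : R) (z : C) : Prop :=
  z <> 0%C /\ 0 < Carg z < PI / 2 /\ Cmod z < rho.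

Definition closure (D : C -> Prop) (z : C) : Prop :=
  forall P : C -> Prop, locally z P -> exists w, P w /\ D w.

Definition punctured_closed_sector (rho : R) (z : C) : Prop :=
  closure (sector rho) z /\ z <> 0%C.

(* Meant for open D: then [ex_diff_n _ 2] at all points of D says that u is
   of class C^2 on D. *)
Definition harmonic_on (D : C -> Prop) (u : C -> R) : Prop :=
  forall z : C, D z ->
    let f := fun x y : R => u (x, y) in
    ex_diff_n f 2 (Re z) (Im z) /\
    partial_derive 2 0 f (Re z) (Im z) + partial_derive 0 2 f (Re z) (Im z) = 0.

(* Supremum in [-oo, +oo] of f over D. *)
Definition sup_on (D : C -> Prop) (f : C -> R) : Rbar :=
  Lub_Rbar (fun t => exists z, D z /\ t = f z).

Definition irrational (x : R) : Prop := ~ exists q : Q, x = Q2R q.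

(* Main.v *)
Require Import Defs.
From Stdlib Require Import Arith Lra Lia List Classical ClassicalEpsilon.
From Stdlib Require Import QArith Reals.
From Coquelicot Require Import Coquelicot.
Open Scope R_scope.

(** The sector is a half-strip in disguise. With [z = rho e^{-t/2} e^{ix/2}]
    the function [u] becomes a harmonic function [V] on [t > 0], [0 < x < PI];
    the origin is sent to [t = +oo], the weight [|z|^l] becomes a multiple of
    [e^{-al t}] with [al = l/2 < 1], the ray of argument [theta] becomes the line
    [x = tau] with [tau = 2 theta], and the singular harmonic functions
    [|z|^{-2k} sin(2k arg z)], which vanish on both edges, become multiples of the
    modes [e^{kt} sin kx]. Three facts then give [V = O(e^{al t})].

    Growth (exponential_growth). The weight [|Im z|^m] only controls [V] by
    [e^{nt}/x^n], which blows up at the edge [x = 0]. Above each short segment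
    of that edge there is a thin triangle, and an explicit superharmonic
    function that is infinite at its two corners dominates [V] on its boundary.
    Hence [V = O(e^{nt})] up to the edge.

    Finite expansion (finite_expansion). Fix a large [T]. On the cross-section
    [t = T] the values of [V] are, up to an error [O(e^{al T})], a sine
    polynomial: they are at most [O(e^{al T})] at the two ends, and sine
    polynomials are dense among the continuous functions that vanish near the
    ends. Extending each sine by its mode and comparing with
    [e^{al t} cos(be (x - PI/2))], [al < be < 1], the maximum principle on
    [0 <= t <= T] bounds [V] minus these modes. The coefficients on the
    cross-section are [O(e^{nT})], so the modes of frequency above [n] have decayed
    to [O(e^{-T})] at any fixed [t]. What remains are the modes [c_k e^{kt} sin kx]
    of frequency at most [n], and the comparison gives
    [|V - sum_k c_k e^{kt} sin kx| = O((1 + m) e^{al t})] up to this error, where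
    [m] is the sum of the [|c_k|].

    Smallness of the coefficients (modes_coefficients_small). Along [x = tau]
    the remaining sum must be [O((1 + m) e^{al t})], because [V] is
    [O(e^{al t})]. As a polynomial in [e^t] without constant term it grows at
    least like [e^t] times the size of its coefficients [c_k sin(k tau)], and [al < 1]. Irrationality of [theta/PI]
    makes every [sin(k tau)] nonzero, so [m] tends to 0 as [T] grows, and the
    bound [O(e^{al t})] for [V] is left. *)

(** * The maximum principle *)

(** Second derivatives are carried as values of a relation, so that sums and
    multiples need no separate existence proofs. *)
Definition is_second_derive (g : R -> R) (x a : R) : Prop :=
  exists g' : R -> R, locally x (fun y => is_derive g y (g' y)) /\ is_derive g' x a.

Definition laplacian_at (f : R -> R -> R) (t x L : R) : Prop :=
  exists A B, is_second_derive (fun s => f s x) t A /\ is_second_derive (fun y => f t y) x B /\ L = A + B.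

Lemma is_second_derive_ext g h x a : (forall y, g y = h y) -> is_second_derive g x a -> is_second_derive h x a.
Proof.
intros E [g' [H1 H2]]. exists g'; split; [|easy]. revert H1. apply filter_imp.
intros y. now apply is_derive_ext.
Qed.

Lemma is_second_derive_plus g h x a b :
  is_second_derive g x a -> is_second_derive h x b -> is_second_derive (fun y => g y + h y) x (a + b).
Proof.
intros [g' [Hg Hg']] [h' [Hh Hh']].
exists (fun y => g' y + h' y); split.
- generalize (filter_and _ _ Hg Hh). apply filter_imp. intros y [H1 H2].
  now apply (is_derive_plus g h).
- now apply (is_derive_plus g' h').
Qed.

Lemma is_second_derive_scal g x a c :
  is_second_derive g x a -> is_second_derive (fun y => c * g y) x (c * a).
Proof.
intros [g' [Hg Hg']].
exists (fun y => c * g' y); split.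
- revert Hg. apply filter_imp. intros y H. now apply (is_derive_scal g).
- now apply (is_derive_scal g').
Qed.

Lemma laplacian_at_plus f g t x L M :
  laplacian_at f t x L -> laplacian_at g t x M ->
  laplacian_at (fun s y => f s y + g s y) t x (L + M).
Proof.
intros [A [B [HA [HB ->]]]] [A' [B' [HA' [HB' ->]]]].
exists (A + A'), (B + B'); split; [|split; [|ring]].
- now apply (is_second_derive_plus (fun s => f s x) (fun s => g s x)).
- now apply (is_second_derive_plus (fun y => f t y) (fun y => g t y)).
Qed.

Lemma laplacian_at_scal f t x L c :
  laplacian_at f t x L -> laplacian_at (fun s y => c * f s y) t x (c * L).
Proof.
intros [A [B [HA [HB ->]]]].
exists (c * A), (c * B); split; [|split; [|ring]].
- now apply (is_second_derive_scal (fun s => f s x)).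
- now apply (is_second_derive_scal (fun y => f t y)).
Qed.

(** At an interior maximum the first derivative vanishes; a positive second
    derivative would make it positive just to the right, where the mean value
    theorem would give larger values. *)
Lemma is_second_derive_local_max g x a :
  is_second_derive g x a -> locally x (fun y => g y <= g x) -> a <= 0.
Proof.
intros [g' [[d1 Hg] Hg']] [d2 Hm].
apply Rnot_lt_le; intros Ha.
assert (Hball : forall (d : posreal) y, Rabs (y - x) < d -> ball x d y).
{ intros d y H. exact H. }
assert (H0 : g' x = 0).
{ assert (Hx : is_derive g x (g' x)).
  { apply Hg. apply ball_center. }
  assert (pr : derivable_pt g x) by (exists (g' x); now apply is_derive_Reals).
  assert (E : derive_pt g x pr = g' x) by (apply derive_pt_eq; now apply is_derive_Reals).
  rewrite <- E. apply (deriv_maximum g (x - d2) (x + d2)).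
  - destruct d2; simpl; lra.
  - destruct d2; simpl; lra.
  - intros y H1 H2. apply Hm. apply Hball. apply Rabs_def1; lra. }
apply is_derive_Reals in Hg'.
destruct (Hg' (a / 2)) as [d3 H3]; [lra|].
set (h := Rmin d1 (Rmin d2 d3) / 2).
assert (Hh : 0 < h /\ h < d1 /\ h < d2 /\ h < d3).
{ unfold h. destruct d1 as [d1 p1], d2 as [d2 p2], d3 as [d3 p3]; simpl in *.
  unfold Rmin; repeat destruct Rle_dec; lra. }
destruct (MVT_cor2 g g' x (x + h)) as [c [Hc1 Hc2]]; [lra| |].
{ intros c Hc. apply is_derive_Reals. apply Hg, Hball. apply Rabs_def1; lra. }
assert (Hle : g (x + h) <= g x).
{ apply Hm, Hball. apply Rabs_def1; lra. }
assert (H4 := H3 (c - x) ltac:(lra) ltac:(apply Rabs_def1; lra)).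
replace (x + (c - x)) with c in H4 by ring. rewrite H0, Rminus_0_r in H4.
apply Rabs_def2 in H4.
assert (Hq : 0 < g' c / (c - x)) by lra.
assert (0 < g' c).
{ replace (g' c) with (g' c / (c - x) * (c - x)) by (field; lra).
  apply Rmult_lt_0_compat; lra. }
nra.
Qed.

Lemma argmax_in_list {A : Type} (f : A -> R) (l : list A) :
  l <> nil -> exists a, In a l /\ forall b, In b l -> f b <= f a.
Proof.
induction l as [|x l IH]; [easy|intros _].
destruct l as [|y l].
- exists x; split; [now left|]. intros b [->|[]]; lra.
- destruct IH as [a [Ha Hm]]; [easy|].
  destruct (Rle_dec (f x) (f a)).
  + exists a; split; [now right|]. intros b [<-|Hb]; auto.
  + exists x; split; [now left|]. intros b [<-|Hb]; [lra|].
    apply Rle_trans with (f a); [auto|lra].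
Qed.


(** The extreme value theorem for upper semicontinuous functions on a compact
    planar set, by extracting a finite subcover. *)
Lemma compact_attains_max (K : R -> R -> Prop) (f : R -> R -> R) (a b c d : R) :
  (forall t x, K t x -> a <= t <= b /\ c <= x <= d) ->
  (forall t x, ~ K t x -> exists e, 0 < e /\
     forall t' x', Rabs (t' - t) < e -> Rabs (x' - x) < e -> ~ K t' x') ->
  (forall t x, K t x -> forall eps, 0 < eps -> exists e, 0 < e /\
     forall t' x', K t' x' -> Rabs (t' - t) < e -> Rabs (x' - x) < e ->
       f t' x' < f t x + eps) ->
  (exists t x, K t x) ->
  exists t x, K t x /\ forall t' x', K t' x' -> f t' x' <= f t x.
Proof.
intros Hb Hcl Hf [t0 [x0 H0]].
apply NNPP; intros Hno.
(* otherwise each point of K is beaten by another one, and so is a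
   neighbourhood of it; the best of finitely many such witnesses is beaten *)
assert (Hbeat : forall t x, K t x -> exists q : R * R, K (fst q) (snd q) /\ f t x < f (fst q) (snd q)).
{ intros t x Hk. apply NNPP; intros Hn. apply Hno. exists t, x; split; [easy|].
  intros t' x' Hk'. apply Rnot_lt_le; intros Hlt. apply Hn. now exists (t', x'). }
assert (Hloc : forall p : R * R, exists eq : posreal * (R * R),
  forall t' x', K t' x' -> Rabs (t' - fst p) < fst eq -> Rabs (x' - snd p) < fst eq ->
    K (fst (snd eq)) (snd (snd eq)) /\ f t' x' < f (fst (snd eq)) (snd (snd eq))).
{ intros [t x]. destruct (classic (K t x)) as [Hk|Hk].
  - destruct (Hbeat t x Hk) as [q [Hq1 Hq2]].
    destruct (Hf t x Hk (f (fst q) (snd q) - f t x)) as [e [He H]]; [lra|].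
    exists (mkposreal e He, q). simpl. intros t' x' Hk' H1 H2.
    split; [easy|]. specialize (H t' x' Hk' H1 H2). lra.
  - destruct (Hcl t x Hk) as [e [He H]].
    exists (mkposreal e He, (t, x)). simpl. intros t' x' Hk' H1 H2.
    now elim (H t' x' H1 H2). }
set (W := fun p => proj1_sig (constructive_indefinite_description _ (Hloc p))).
assert (HW : forall p t' x', K t' x' ->
  Rabs (t' - fst p) < fst (W p) -> Rabs (x' - snd p) < fst (W p) ->
    K (fst (snd (W p))) (snd (snd (W p))) /\
    f t' x' < f (fst (snd (W p))) (snd (snd (W p)))).
{ intros p. exact (proj2_sig (constructive_indefinite_description _ (Hloc p))). }
apply (compactness_list 2 (a, (c, tt)) (b, (d, tt))
  (fun v => fst (W (fst v, fst (snd v))))).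
intros [l Hl].
assert (Hcov : forall t x, K t x -> exists p, In p (map (fun v : Compactness.Tn 2 R => (fst v, fst (snd v))) l) /\
   K (fst (snd (W p))) (snd (snd (W p))) /\
    f t x < f (fst (snd (W p))) (snd (snd (W p)))).
{ intros t x Hk. destruct (Hl (t, (x, tt))) as [[v1 [v2 []]] [Hv [_ Hc]]].
  - destruct (Hb t x Hk). simpl. tauto.
  - exists (v1, v2). split.
    + change (v1, v2) with ((fun v : Compactness.Tn 2 R => (fst v, fst (snd v))) (v1, (v2, tt))).
      apply in_map. exact Hv.
    + simpl in Hc. apply HW; simpl; tauto. }
set (l' := map _ l) in Hcov.
set (good := fun p => if excluded_middle_informative (K (fst (snd (W p))) (snd (snd (W p)))) then true else false).
destruct (argmax_in_list (fun p => f (fst (snd (W p))) (snd (snd (W p)))) (filter good l'))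
  as [p [Hp Hmax]].
- destruct (Hcov t0 x0 H0) as [p [Hp [Hk _]]].
  intros E. assert (Hin : In p (filter good l')).
  { apply filter_In; split; [easy|]. unfold good. now destruct excluded_middle_informative. }
  rewrite E in Hin. easy.
- apply filter_In in Hp. destruct Hp as [_ Hg]. unfold good in Hg.
  destruct excluded_middle_informative as [Hk|]; [|easy].
  destruct (Hcov _ _ Hk) as [p' [Hp' [Hk' Hlt]]].
  specialize (Hmax p'). apply (Rlt_not_le _ _ Hlt), Hmax.
  apply filter_In; split; [easy|]. unfold good. now destruct excluded_middle_informative.
Qed.

(** With a strictly positive Laplacian, the maximum cannot be attained at an
    interior point where the function is positive. The set [K] is arbitrary
    because it is used for both rectangles and triangles. *)
Lemma max_principle (K : R -> R -> Prop) (f : R -> R -> R) (a b c d : R) :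
  (forall t x, K t x -> a <= t <= b /\ c <= x <= d) ->
  (forall t x, ~ K t x -> exists e, 0 < e /\
     forall t' x', Rabs (t' - t) < e -> Rabs (x' - x) < e -> ~ K t' x') ->
  (forall t x, K t x -> forall eps, 0 < eps -> exists e, 0 < e /\
     forall t' x', K t' x' -> Rabs (t' - t) < e -> Rabs (x' - x) < e ->
       f t' x' < f t x + eps) ->
  (forall t x, K t x -> f t x <= 0 \/
     ((exists L, 0 < L /\ laplacian_at f t x L) /\ locally_2d K t x)) ->
  forall t x, K t x -> f t x <= 0.
Proof.
intros Hb Hcl Hf Hlap t x Hk.
destruct (compact_attains_max K f a b c d Hb Hcl Hf) as [t1 [x1 [Hk1 Hmax]]].
{ now exists t, x. }
apply Rle_trans with (f t1 x1); [auto|].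
destruct (Hlap t1 x1 Hk1) as [H|[[L [HL [A [B [HA [HB E]]]]]] Hint]]; [easy|exfalso].
assert (A <= 0).
{ apply (is_second_derive_local_max _ _ _ HA). apply locally_2d_1d_const_y in Hint.
  revert Hint. apply filter_imp. intros y Hy. now apply Hmax. }
assert (B <= 0).
{ apply (is_second_derive_local_max _ _ _ HB). apply locally_2d_1d_const_x in Hint.
  revert Hint. apply filter_imp. intros y Hy. now apply Hmax. }
lra.
Qed.

(** * Harmonic functions on the half-strip *)

(** Continuity is relative to the closed half-strip, because the values of
    [V] elsewhere are arbitrary. *)
Definition strip_continuous (V : R -> R -> R) : Prop :=
  forall t x, 0 <= t -> 0 <= x <= PI -> forall eps, 0 < eps -> exists e, 0 < e /\
    forall t' x', 0 <= t' -> 0 <= x' <= PI -> Rabs (t' - t) < e -> Rabs (x' - x) < e ->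
      Rabs (V t' x' - V t x) < eps.

Definition strip_harmonic (V : R -> R -> R) : Prop :=
  forall t x, 0 < t -> 0 < x < PI -> laplacian_at V t x 0.

Lemma strip_max_principle (V g : R -> R -> R) (K : R -> R -> Prop) (T : R) :
  strip_continuous V ->
  (forall t x, K t x -> 0 <= t <= T /\ 0 <= x <= PI) ->
  (forall t x, ~ K t x -> exists e, 0 < e /\
     forall t' x', Rabs (t' - t) < e -> Rabs (x' - x) < e -> ~ K t' x') ->
  (forall t x, K t x -> continuity_2d_pt g t x) ->
  (forall t x, K t x -> V t x + g t x <= 0 \/
     ((exists L, 0 < L /\ laplacian_at (fun s y => V s y + g s y) t x L) /\ locally_2d K t x)) ->
  forall t x, K t x -> V t x + g t x <= 0.
Proof.
intros HV Hb Hcl Hg Hlap.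
apply (max_principle K (fun t x => V t x + g t x) 0 T 0 PI Hb Hcl); [|exact Hlap].
intros t x Hk eps Heps.
destruct (Hb t x Hk) as [Ht Hx].
destruct (HV t x (proj1 Ht) Hx (eps / 2)) as [e1 [He1 H1]]; [lra|].
assert (He : 0 < eps / 2) by lra.
destruct (Hg t x Hk (mkposreal _ He)) as [e2 H2]. simpl in H2.
exists (Rmin e1 e2); split.
- apply Rmin_pos; [easy|apply cond_pos].
- intros t' x' Hk' Ht' Hx'. destruct (Hb t' x' Hk') as [Ht'' Hx''].
  assert (Hm1 := Rmin_l e1 e2). assert (Hm2 := Rmin_r e1 e2).
  specialize (H1 t' x' ltac:(lra) Hx'' ltac:(lra) ltac:(lra)).
  specialize (H2 t' x' ltac:(lra) ltac:(lra)).
  apply Rabs_def2 in H1. apply Rabs_def2 in H2. lra.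
Qed.

(** * From a blow-up at the edge to exponential growth *)

(** The negative power [s^{-n}] of the distance [s = e (t - a)] to the corner
    [(a, 0)] along the edge, corrected by a term quadratic in [x] which makes it
    superharmonic. The sign [e = 1] or [e = -1] tells on which side of the
    corner the point lies. *)
Definition barrier (n : nat) (e a t x : R) : R :=
  / (e * (t - a)) ^ n - INR n * (INR n + 1) * x ^ 2 * / (e * (t - a)) ^ (n + 2).

Lemma is_derive_inv_pow (n : nat) (e a t : R) : e * (t - a) <> 0 ->
  is_derive (fun s => / (e * (s - a)) ^ n) t (- (INR n * e) * / (e * (t - a)) ^ (S n)).
Proof.
intros H. destruct n as [|n].
- simpl. replace (- (0 * e) * _) with 0 by ring. apply (is_derive_const (/ 1)).
- auto_derive. { now apply (pow_nonzero _ (S n)). }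
  change (match n with O => 1 | S _ => INR n + 1 end) with (INR (S n)).
  rewrite <- !tech_pow_Rmult. simpl pred.
  change (t + - a) with (t - a). set (s := e * (t - a)) in *.
  assert (Hn := pow_nonzero s n H). set (q := s ^ n) in *. field. now split.
Qed.

Lemma is_second_derive_inv_pow (n : nat) (e a t : R) : e = 1 \/ e = -1 -> 0 < e * (t - a) ->
  is_second_derive (fun s => / (e * (s - a)) ^ n) t
    (INR n * (INR n + 1) * / (e * (t - a)) ^ (n + 2)).
Proof.
intros He H.
exists (fun s => - (INR n * e) * / (e * (s - a)) ^ (S n)); split.
- exists (mkposreal _ H). intros y Hy. apply is_derive_inv_pow.
  change (Rabs (y - t) < e * (t - a)) in Hy. apply Rabs_def2 in Hy.
  destruct He as [-> | ->]; lra.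
- evar_last. { apply is_derive_scal. apply is_derive_inv_pow. lra. }
  rewrite S_INR. replace (S (S n)) with (n + 2)%nat by lia.
  destruct He as [-> | ->]; ring.
Qed.

(** The second [x]-derivative of the correction is twice the opposite of the
    second [t]-derivative of the leading term, and the other contribution is
    nonpositive. *)
Lemma barrier_superharmonic (n : nat) (e a t x : R) : (1 <= n)%nat ->
  e = 1 \/ e = -1 -> 0 < e * (t - a) ->
  exists L, L < 0 /\ laplacian_at (barrier n e a) t x L.
Proof.
intros Hn He H.
assert (HN : 1 <= INR n) by now apply (le_INR 1).
set (N := INR n) in *. set (s := e * (t - a)) in *.
assert (Hp : 0 < / s ^ (n + 2)) by (apply Rinv_0_lt_compat; now apply pow_lt).
assert (Hq : 0 < / s ^ (n + 2 + 2)) by (apply Rinv_0_lt_compat; now apply pow_lt).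
set (A := N * (N + 1) * / s ^ (n + 2) +
   - (N * (N + 1) * x ^ 2) * (INR (n + 2) * (INR (n + 2) + 1) * / s ^ (n + 2 + 2))).
set (B := - (N * (N + 1) * / s ^ (n + 2)) * 2).
exists (A + B); split.
- unfold A, B. rewrite plus_INR. fold N. simpl INR.
  assert (0 <= x ^ 2) by apply pow2_ge_0.
  assert (0 < N * (N + 1) * / s ^ (n + 2)) by (apply Rmult_lt_0_compat; nra).
  assert (0 <= (N * (N + 1) * x ^ 2) * ((N + (1 + 1)) * (N + (1 + 1) + 1) * / s ^ (n + 2 + 2))).
  { generalize dependent (x ^ 2). intros q2 _ Hq2. repeat apply Rmult_le_pos; lra. }
  lra.
- exists A, B; split; [|split; [|reflexivity]].
  + apply (is_second_derive_ext (fun u => / (e * (u - a)) ^ n +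
      - (N * (N + 1) * x ^ 2) * / (e * (u - a)) ^ (n + 2))).
    { intros u. unfold barrier. fold N. ring. }
    apply (is_second_derive_plus (fun u => / (e * (u - a)) ^ n)).
    * now apply is_second_derive_inv_pow.
    * now apply (is_second_derive_scal (fun u => / (e * (u - a)) ^ (n + 2))), is_second_derive_inv_pow.
  + exists (fun y => - (N * (N + 1) * / s ^ (n + 2)) * (2 * y)); split.
    * apply filter_forall. intros y. unfold barrier. fold N s. auto_derive; [easy|ring].
    * unfold B. auto_derive; [easy|ring].
Qed.

(** Close enough to the edge, the correction removes at most half of the
    leading term. *)
Lemma barrier_ge (n : nat) (e a t x : R) : 0 < e * (t - a) ->
  0 <= x <= / (2 * (INR n + 1)) * (e * (t - a)) ->
  / (2 * (e * (t - a)) ^ n) <= barrier n e a t x.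
Proof.
intros H Hx. unfold barrier. set (s := e * (t - a)) in *.
assert (HN := pos_INR n). set (N := INR n) in *.
assert (Hs : 0 < s ^ n) by now apply pow_lt.
assert (Hx2 : x ^ 2 <= (/ (2 * (N + 1)) * s) ^ 2) by (apply pow_incr; lra).
assert (Hk : N * (N + 1) * x ^ 2 <= / 2 * s ^ 2).
{ apply Rle_trans with (N * (N + 1) * (/ (2 * (N + 1)) * s) ^ 2).
  - apply Rmult_le_compat_l; nra.
  - replace (N * (N + 1) * (/ (2 * (N + 1)) * s) ^ 2) with (N / (4 * (N + 1)) * s ^ 2) by (field; lra).
    apply Rmult_le_compat_r; [nra|].
    apply Rmult_le_reg_r with (4 * (N + 1)); [lra|]. field_simplify; lra. }
assert (Hd : N * (N + 1) * x ^ 2 * / s ^ (n + 2) <= / 2 * / s ^ n).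
{ replace (/ 2 * / s ^ n) with (/ 2 * s ^ 2 * / s ^ (n + 2)).
  - apply Rmult_le_compat_r; [|easy]. left. apply Rinv_0_lt_compat. now apply pow_lt.
  - rewrite pow_add. field. lra. }
rewrite Rinv_mult. lra.
Qed.

Lemma barrier_continuous (n : nat) (e a t x : R) : 0 < e * (t - a) ->
  continuity_2d_pt (barrier n e a) t x.
Proof.
intros H. unfold barrier.
assert (Hi : forall m, continuity_2d_pt (fun s _ => / (e * (s - a)) ^ m) t x).
{ intros m. apply (continuity_1d_2d_pt_comp (fun s => / (e * (s - a)) ^ m) (fun s _ => s)).
  - apply continuity_pt_filterlim. apply (ex_derive_continuous (fun s => / (e * (s - a)) ^ m)).
    eexists. apply is_derive_inv_pow. lra.
  - apply continuity_2d_pt_id1. }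
apply continuity_2d_pt_minus; [apply Hi|].
apply continuity_2d_pt_mult; [|apply Hi].
apply (continuity_1d_2d_pt_comp (fun y => INR n * (INR n + 1) * y ^ 2) (fun _ y => y)).
- apply continuity_pt_filterlim. apply (ex_derive_continuous (fun y => INR n * (INR n + 1) * y ^ 2)).
  auto_derive. easy.
- apply continuity_2d_pt_id2.
Qed.

(** The comparison takes place on the triangle with corners [(t0 - 1, 0)] and
    [(t0 + 1, 0)] whose slanted sides have the small slope [c]. On these sides
    [x] is comparable with the distance to the nearer corner, so that [C/x^n] is
    dominated by the barrier of that corner. Cutting off the corners at distance
    [d] is harmless: there [V] is bounded by continuity while the barrier is at
    least of order [1/d]. *)
Lemma triangle_bound (V : R -> R -> R) (n : nat) (C t0 : R) :
  (1 <= n)%nat -> 0 < C -> 1 <= t0 ->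
  strip_continuous V -> strip_harmonic V ->
  (forall t, t0 - 1 <= t <= t0 + 1 -> V t 0 <= C) ->
  (forall t x, t0 - 1 < t < t0 + 1 -> 0 < x < PI -> x ^ n * V t x <= C) ->
  forall x, 0 <= x <= / (2 * (INR n + 1)) ->
    V t0 x <= 4 * C / (/ (2 * (INR n + 1))) ^ n.
Proof.
intros Hn HC Ht0 Hcont Hharm Hedge Hint x Hx.
assert (HN : 1 <= INR n) by now apply (le_INR 1).
set (c := / (2 * (INR n + 1))) in *.
assert (Hc : 0 < c <= / 4).
{ unfold c. split; [apply Rinv_0_lt_compat; lra|]. apply Rinv_le_contravar; lra. }
assert (Hcn : 0 < c ^ n <= 1).
{ split; [apply pow_lt; lra|]. rewrite <- (pow1 n). apply pow_incr; lra. }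
set (A := 2 * C / c ^ n).
assert (HA : 0 < A) by (apply Rdiv_lt_0_compat; lra).
assert (HA2 : 2 * C <= A).
{ unfold A. apply Rmult_le_reg_r with (c ^ n); [lra|].
  replace (2 * C / c ^ n * c ^ n) with (2 * C) by (field; lra). nra. }
destruct (Hcont (t0 - 1) 0) with (eps := 1) as [e1 [He1 H1]]; [lra| |lra|].
{ pose proof PI_RGT_0; lra. }
destruct (Hcont (t0 + 1) 0) with (eps := 1) as [e2 [He2 H2]]; [lra| |lra|].
{ pose proof PI_RGT_0; lra. }
pose proof PI_RGT_0 as Hpi0. pose proof PI2_1 as Hpi1.
set (B := Rabs (V (t0 - 1) 0) + Rabs (V (t0 + 1) 0) + 1).
assert (HB1 := Rle_abs (V (t0 - 1) 0)). assert (HB2 := Rle_abs (V (t0 + 1) 0)).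
assert (HB3 := Rabs_pos (V (t0 - 1) 0)). assert (HB4 := Rabs_pos (V (t0 + 1) 0)).
assert (HB : 1 <= B) by (unfold B; lra).
set (d := Rmin (/ 2) (Rmin (e1 / 2) (Rmin (e2 / 2) (A / (2 * B))))).
assert (Hd : 0 < d /\ d <= / 2 /\ d < e1 /\ d < e2 /\ d <= A / (2 * B)).
{ assert (0 < A / (2 * B)) by (apply Rdiv_lt_0_compat; lra).
  unfold d. unfold Rmin; repeat destruct Rle_dec; lra. }
destruct Hd as [Hd0 [Hd1 [Hd2 [Hd3 Hd4]]]].
assert (HdB : 2 * B * d <= A).
{ apply Rmult_le_compat_l with (r := 2 * B) in Hd4; [|lra].
  replace (2 * B * (A / (2 * B))) with A in Hd4 by (field; lra). lra. }
set (g := fun s y => - A * (barrier n 1 (t0 - 1) s y + barrier n (-1) (t0 + 1) s y)).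
set (K := fun s y => t0 - 1 + d <= s <= t0 + 1 - d /\ 0 <= y /\
   y <= c * (s - (t0 - 1)) /\ y <= c * (t0 + 1 - s)).
assert (HE1 : forall s y, K s y -> 0 < 1 * (s - (t0 - 1)) /\ 0 < -1 * (s - (t0 + 1)) /\
   / (2 * (1 * (s - (t0 - 1))) ^ n) <= barrier n 1 (t0 - 1) s y /\
   / (2 * (-1 * (s - (t0 + 1))) ^ n) <= barrier n (-1) (t0 + 1) s y).
{ intros s y [Hs [Hy [Hy1 Hy2]]]. split; [lra|]. split; [lra|].
  split; apply barrier_ge; try lra; fold c; split; try lra. }
(* with sg the distance to one corner along the edge, a bound of order
   1/sg^n is enough *)
assert (Hclose : forall (v s y sg : R), K s y -> 0 < sg <= 1 ->
   (sg = 1 * (s - (t0 - 1)) \/ sg = -1 * (s - (t0 + 1))) ->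
   sg ^ n * v <= A / 2 -> v + g s y <= 0).
{ intros v s y sg Hk Hsg Heq Hv. destruct (HE1 s y Hk) as [Hp1 [Hp2 [Hb1 Hb2]]].
  assert (Hq1 : 0 < / (2 * (1 * (s - (t0 - 1))) ^ n)).
  { apply Rinv_0_lt_compat. apply Rmult_lt_0_compat; [lra|]. now apply pow_lt. }
  assert (Hq2 : 0 < / (2 * (-1 * (s - (t0 + 1))) ^ n)).
  { apply Rinv_0_lt_compat. apply Rmult_lt_0_compat; [lra|]. now apply pow_lt. }
  assert (Hsn : 0 < sg ^ n) by (apply pow_lt; lra).
  assert (Hsum : / (2 * sg ^ n) <= barrier n 1 (t0 - 1) s y + barrier n (-1) (t0 + 1) s y).
  { destruct Heq as [-> | ->]; lra. }
  assert (Hv2 : v <= A * / (2 * sg ^ n)).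
  { apply Rmult_le_reg_l with (sg ^ n); [easy|].
    replace (sg ^ n * (A * / (2 * sg ^ n))) with (A / 2) by (field; lra). easy. }
  unfold g. apply Rmult_le_compat_l with (r := A) in Hsum; lra. }
assert (Hmain : forall s y, K s y -> V s y + g s y <= 0).
{ apply (strip_max_principle V g K (t0 + 1)); [easy| | | |].
  - intros s y [Hs [Hy [Hy1 Hy2]]]. split; [lra|]. split; [lra|]. nra.
  - intros s y Hnk.
    assert (Hv : exists v, 0 < v /\ (v = t0 - 1 + d - s \/ v = s - (t0 + 1 - d) \/ v = - y \/
       v = y - c * (s - (t0 - 1)) \/ v = y - c * (t0 + 1 - s))).
    { apply NNPP; intros Hno. apply Hnk. unfold K.
      assert (Hall : forall v, (v = t0 - 1 + d - s \/ v = s - (t0 + 1 - d) \/ v = - y \/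
       v = y - c * (s - (t0 - 1)) \/ v = y - c * (t0 + 1 - s)) -> v <= 0).
      { intros v Hv. apply Rnot_lt_le; intros Hlt. apply Hno. now exists v. }
      assert (G1 := Hall _ (or_introl eq_refl)).
      assert (G2 := Hall _ (or_intror (or_introl eq_refl))).
      assert (G3 := Hall _ (or_intror (or_intror (or_introl eq_refl)))).
      assert (G4 := Hall _ (or_intror (or_intror (or_intror (or_introl eq_refl))))).
      assert (G5 := Hall _ (or_intror (or_intror (or_intror (or_intror eq_refl))))).
      lra. }
    destruct Hv as [v [Hv0 Hv]].
    exists (v / 2); split; [lra|]. intros s' y' Hs' Hy' [Hs [Hy [Hy1 Hy2]]].
    apply Rabs_def2 in Hs'. apply Rabs_def2 in Hy'.
    assert (c * (s' - s) <= v / 2) by nra. assert (- (v / 2) <= c * (s' - s)) by nra.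
    destruct Hv as [Hv|[Hv|[Hv|[Hv|Hv]]]]; lra.
  - intros s y Hk. destruct (HE1 s y Hk) as [Hp1 [Hp2 _]]. unfold g.
    apply continuity_2d_pt_mult; [apply continuity_2d_pt_const|].
    apply continuity_2d_pt_plus; now apply barrier_continuous.
  - intros s y Hk. pose proof Hk as [Hs [Hy [Hy1 Hy2]]].
    assert (Hcorner : forall e sc, 0 < e -> d < e -> 0 <= sc -> V sc 0 + 1 <= B ->
       (forall t' x', 0 <= t' -> 0 <= x' <= PI -> Rabs (t' - sc) < e -> Rabs (x' - 0) < e ->
         Rabs (V t' x' - V sc 0) < 1) ->
       Rabs (s - sc) = d -> 0 <= y <= c * d -> d ^ n * V s y <= A / 2).
    { intros e sc He Hde Hsc HVB Hnear Hsd Hyd.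
      assert (Hyd2 : c * d <= d) by nra.
      specialize (Hnear s y ltac:(lra) ltac:(nra) ltac:(lra) ltac:(rewrite Rabs_pos_eq; lra)).
      apply Rabs_def2 in Hnear.
      assert (Hdn : 0 < d ^ n <= d).
      { split; [now apply pow_lt|]. destruct n as [|k]; [lia|].
        simpl. assert (d ^ k <= 1) by (rewrite <- (pow1 k); apply pow_incr; lra). nra. }
      apply Rle_trans with (d ^ n * B); nra. }
    destruct (Rle_dec s (t0 - 1 + d)) as [Hl|Hl].
    { left. apply (Hclose _ _ _ d Hk); [lra|left; lra|].
      apply (Hcorner e1 (t0 - 1)); try easy; try lra.
      - unfold B; lra.
      - rewrite Rabs_pos_eq; lra.
      - replace d with (s - (t0 - 1)) by lra. lra. }
    destruct (Rle_dec (t0 + 1 - d) s) as [Hr|Hr].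
    { left. apply (Hclose _ _ _ d Hk); [lra|right; lra|].
      apply (Hcorner e2 (t0 + 1)); try easy; try lra.
      - unfold B; lra.
      - rewrite Rabs_left; lra.
      - replace d with (t0 + 1 - s) by lra. lra. }
    destruct (Req_dec y 0) as [Hy0|Hy0].
    { left. subst y. assert (HVC : V s 0 <= C) by (apply Hedge; lra).
      assert (Hone : forall sg, 0 < sg <= 1 -> sg ^ n * V s 0 <= A / 2).
      { intros sg Hsg. assert (0 < sg ^ n <= 1).
        { split; [now apply pow_lt|]. rewrite <- (pow1 n). apply pow_incr; lra. }
        apply Rle_trans with (sg ^ n * C); nra. }
      destruct (Rle_dec s t0).
      - apply (Hclose _ _ _ (1 * (s - (t0 - 1))) Hk); [lra|now left|]. apply Hone; lra.
      - apply (Hclose _ _ _ (-1 * (s - (t0 + 1))) Hk); [lra|now right|]. apply Hone; lra. }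
    assert (Hslant : forall sg, 0 < sg <= 1 -> y = c * sg -> sg ^ n * V s y <= A / 2).
    { intros sg Hsg Eq. assert (Hi := Hint s y ltac:(lra) ltac:(nra)).
      rewrite Eq in Hi at 1. rewrite Rpow_mult_distr in Hi.
      unfold A. apply Rmult_le_reg_l with (c ^ n); [lra|].
      replace (c ^ n * (2 * C / c ^ n / 2)) with C by (field; lra). lra. }
    destruct (Rle_dec (c * (s - (t0 - 1))) y) as [Hsl|Hsl].
    { left. assert (s - (t0 - 1) <= 1) by nra.
      apply (Hclose _ _ _ (1 * (s - (t0 - 1))) Hk); [lra|now left|]. apply Hslant; lra. }
    destruct (Rle_dec (c * (t0 + 1 - s)) y) as [Hsr|Hsr].
    { left. assert (t0 + 1 - s <= 1) by nra.
      apply (Hclose _ _ _ (-1 * (s - (t0 + 1))) Hk); [lra|now right|]. apply Hslant; [lra|].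
      replace (-1 * (s - (t0 + 1))) with (t0 + 1 - s) by ring. lra. }
    right. split.
    + destruct (HE1 s y Hk) as [Hp1 [Hp2 _]].
      destruct (barrier_superharmonic n 1 (t0 - 1) s y Hn) as [L1 [HL1 HH1]]; [now left|easy|].
      destruct (barrier_superharmonic n (-1) (t0 + 1) s y Hn) as [L2 [HL2 HH2]]; [now right|easy|].
      exists (0 + - A * (L1 + L2)); split; [nra|].
      apply laplacian_at_plus.
      * apply Hharm; [lra|]. split; [lra|nra].
      * apply (laplacian_at_scal (fun s y => barrier n 1 (t0 - 1) s y + barrier n (-1) (t0 + 1) s y)).
        now apply laplacian_at_plus.
    + set (m := Rmin (Rmin (s - (t0 - 1 + d)) (t0 + 1 - d - s)) (Rmin y
         (Rmin (c * (s - (t0 - 1)) - y) (c * (t0 + 1 - s) - y)))).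
      assert (Hm : 0 < m /\ m <= s - (t0 - 1 + d) /\ m <= t0 + 1 - d - s /\ m <= y /\
        m <= c * (s - (t0 - 1)) - y /\ m <= c * (t0 + 1 - s) - y).
      { unfold m. unfold Rmin; repeat destruct Rle_dec; lra. }
      assert (Hm2 : 0 < m / 2) by lra.
      exists (mkposreal _ Hm2). simpl. intros s' y' Hs' Hy'.
      apply Rabs_def2 in Hs'. apply Rabs_def2 in Hy'.
      assert (c * (s' - s) <= m / 2) by nra. assert (- (m / 2) <= c * (s' - s)) by nra.
      unfold K. lra. }
assert (Hk0 : K t0 x) by (unfold K; lra).
specialize (Hmain t0 x Hk0). unfold g, barrier in Hmain.
replace (1 * (t0 - (t0 - 1))) with 1 in Hmain by ring.
replace (-1 * (t0 - (t0 + 1))) with 1 in Hmain by ring.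
rewrite !pow1, Rinv_1 in Hmain.
assert (0 <= INR n * (INR n + 1) * x ^ 2).
{ apply Rmult_le_pos; [nra|apply pow2_ge_0]. }
replace (4 * C / c ^ n) with (2 * A) by (unfold A; field; lra).
nra.
Qed.

Lemma strip_continuous_opp V : strip_continuous V -> strip_continuous (fun t x => - V t x).
Proof.
intros H t x Ht Hx eps He. destruct (H t x Ht Hx eps He) as [e [He' H']].
exists e; split; [easy|]. intros t' x' Ht' Hx' H1 H2.
specialize (H' t' x' Ht' Hx' H1 H2). apply Rabs_def2 in H'. apply Rabs_def1; lra.
Qed.

Lemma strip_harmonic_opp V : strip_harmonic V -> strip_harmonic (fun t x => - V t x).
Proof.
intros H t x Ht Hx.
destruct (H t x Ht Hx) as [A [B [HA [HB E]]]].
exists (-1 * A), (-1 * B). split; [|split; [|lra]].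
- apply (is_second_derive_ext (fun s => -1 * V s x)); [intros; ring|now apply (is_second_derive_scal (fun s => V s x))].
- apply (is_second_derive_ext (fun y => -1 * V t y)); [intros; ring|now apply (is_second_derive_scal (fun y => V t y))].
Qed.

Lemma rectangle_neighbourhood (T t x : R) : ~ (0 <= t <= T /\ 0 <= x <= PI) ->
  exists e, 0 < e /\ forall t' x', Rabs (t' - t) < e -> Rabs (x' - x) < e ->
    ~ (0 <= t' <= T /\ 0 <= x' <= PI).
Proof.
intros Hn.
assert (Hv : exists v, 0 < v /\ (v = - t \/ v = t - T \/ v = - x \/ v = x - PI)).
{ destruct (Rlt_dec 0 (- t)); [eexists; split; [eassumption|tauto]|].
  destruct (Rlt_dec 0 (t - T)); [eexists; split; [eassumption|tauto]|].
  destruct (Rlt_dec 0 (- x)); [eexists; split; [eassumption|tauto]|].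
  destruct (Rlt_dec 0 (x - PI)); [eexists; split; [eassumption|tauto]|].
  elim Hn. lra. }
destruct Hv as [v [Hv0 Hv]]. exists v; split; [easy|]. intros t' x' H1 H2 [H3 H4].
apply Rabs_def2 in H1. apply Rabs_def2 in H2. lra.
Qed.

Lemma strip_continuous_bounded V T : 0 <= T -> strip_continuous V ->
  exists B, forall t x, 0 <= t <= T -> 0 <= x <= PI -> Rabs (V t x) <= B.
Proof.
intros HT HV.
destruct (compact_attains_max (fun t x => 0 <= t <= T /\ 0 <= x <= PI) (fun t x => Rabs (V t x)) 0 T 0 PI)
  as [t1 [x1 [_ Hmax]]].
- easy.
- apply rectangle_neighbourhood.
- intros t x [Ht Hx] eps He. destruct (HV t x (proj1 Ht) Hx eps He) as [e [He' H]].
  exists e; split; [easy|]. intros t' x' [Ht' Hx'] H1 H2.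
  specialize (H t' x' (proj1 Ht') Hx' H1 H2).
  apply Rabs_def2 in H. apply Rabs_def1.
  + assert (H3 := Rle_abs (V t x)). lra.
  + assert (H3 := Rle_abs (- V t x)). rewrite Rabs_Ropp in H3. lra.
- exists 0, 0. pose proof PI_RGT_0. lra.
- exists (Rabs (V t1 x1)). auto.
Qed.

(** For [t <= 1] this is compactness. For larger [t], the bound [C e^{nt}/x^n] is good
    enough when [x >= c], and the triangle above [[t - 1, t + 1]] gives the
    smaller [x], for [V] and for [-V]. *)
Lemma exponential_growth (V : R -> R -> R) (n : nat) (C : R) :
  (1 <= n)%nat -> 0 < C -> strip_continuous V -> strip_harmonic V ->
  (forall t, 0 <= t -> Rabs (V t 0) <= C * exp (INR n * t)) ->
  (forall t, 0 <= t -> Rabs (V t PI) <= C * exp (INR n * t)) ->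
  (forall t x, 0 < t -> 0 < x < PI -> x ^ n * Rabs (V t x) <= C * exp (INR n * t)) ->
  exists D, 0 < D /\ forall t x, 0 <= t -> 0 <= x <= PI -> Rabs (V t x) <= D * exp (INR n * t).
Proof.
intros Hn HC Hcont Hharm H0 Hpi Hint.
assert (HN : 1 <= INR n) by now apply (le_INR 1).
set (c := / (2 * (INR n + 1))).
assert (Hc : 0 < c <= / 4).
{ unfold c. split; [apply Rinv_0_lt_compat; lra|]. apply Rinv_le_contravar; lra. }
assert (Hcn : 0 < c ^ n <= 1).
{ split; [apply pow_lt; lra|]. rewrite <- (pow1 n). apply pow_incr; lra. }
destruct (strip_continuous_bounded V 1 ltac:(lra) Hcont) as [B HB].
assert (HBp := HB 0 0 ltac:(lra) ltac:(pose proof PI_RGT_0; lra)).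
assert (HBp2 := Rabs_pos (V 0 0)).
set (D1 := 4 * (C * exp (INR n)) / c ^ n).
assert (HE : 1 < exp (INR n)) by (rewrite <- exp_0; apply exp_increasing; lra).
assert (HD1 : C / c ^ n <= D1).
{ unfold D1, Rdiv. apply Rmult_le_compat_r; [left; apply Rinv_0_lt_compat; lra|nra]. }
assert (HCc : C <= C / c ^ n).
{ apply Rmult_le_reg_r with (c ^ n); [lra|]. replace (C / c ^ n * c ^ n) with C by (field; lra). nra. }
exists (D1 + B); split; [lra|].
intros t x Ht Hx.
assert (Hexp : 1 <= exp (INR n * t)).
{ rewrite <- exp_0. destruct (Req_dec t 0) as [->|Hne]; [rewrite Rmult_0_r; lra|].
  left. apply exp_increasing. apply Rmult_lt_0_compat; lra. }
destruct (Rle_dec t 1) as [Ht1|Ht1].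
{ specialize (HB t x ltac:(lra) Hx). nra. }
assert (HgoalD : Rabs (V t x) <= D1 * exp (INR n * t) -> Rabs (V t x) <= (D1 + B) * exp (INR n * t)).
{ intros; nra. }
apply HgoalD.
destruct (Rle_dec x c) as [Hxc|Hxc].
- assert (Hmono : forall s, s <= t + 1 -> exp (INR n * s) <= exp (INR n) * exp (INR n * t)).
  { intros s Hs. rewrite <- exp_plus. replace (INR n + INR n * t) with (INR n * (t + 1)) by ring.
    destruct (Req_dec s (t + 1)) as [->|Hne]; [lra|]. left; apply exp_increasing.
    apply Rmult_lt_compat_l; lra. }
  set (C' := C * (exp (INR n) * exp (INR n * t))).
  assert (HC' : 0 < C') by (unfold C'; repeat apply Rmult_lt_0_compat; try apply exp_pos; lra).
  assert (Hsame : 4 * C' / c ^ n = D1 * exp (INR n * t)) by (unfold D1, C'; field; lra).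
  rewrite <- Hsame.
  apply Rabs_le. split.
  + assert (Htri := triangle_bound (fun t x => - V t x) n C' t Hn HC' ltac:(lra)
      (strip_continuous_opp _ Hcont) (strip_harmonic_opp _ Hharm)).
    cbv beta in Htri. fold c in Htri.
    enough (- V t x <= 4 * C' / c ^ n) by lra.
    apply Htri; [| |lra].
    * intros s Hs. specialize (H0 s ltac:(lra)). specialize (Hmono s ltac:(lra)).
      apply Rle_trans with (Rabs (V s 0)); [rewrite <- Rabs_Ropp; apply Rle_abs|].
      unfold C'. nra.
    * intros s y Hs Hy. specialize (Hint s y ltac:(lra) Hy). specialize (Hmono s ltac:(lra)).
      apply Rle_trans with (y ^ n * Rabs (V s y)).
      { apply Rmult_le_compat_l; [left; now apply pow_lt|]. rewrite <- Rabs_Ropp; apply Rle_abs. }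
      unfold C'. nra.
  + assert (Htri := triangle_bound V n C' t Hn HC' ltac:(lra) Hcont Hharm).
    fold c in Htri. apply Htri; [| |lra].
    * intros s Hs. specialize (H0 s ltac:(lra)). specialize (Hmono s ltac:(lra)).
      apply Rle_trans with (Rabs (V s 0)); [apply Rle_abs|].
      unfold C'. nra.
    * intros s y Hs Hy. specialize (Hint s y ltac:(lra) Hy). specialize (Hmono s ltac:(lra)).
      apply Rle_trans with (y ^ n * Rabs (V s y)).
      { apply Rmult_le_compat_l; [left; now apply pow_lt|]. apply Rle_abs. }
      unfold C'. nra.
- apply Rle_trans with (C / c ^ n * exp (INR n * t)); [|nra].
  destruct (Req_dec x PI) as [->|Hxpi].
  + apply Rle_trans with (1 := Hpi t Ht). nra.
  + specialize (Hint t x ltac:(lra) ltac:(lra)).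
    assert (Hcx : c ^ n <= x ^ n) by (apply pow_incr; lra).
    apply Rmult_le_reg_l with (c ^ n); [lra|].
    replace (c ^ n * (C / c ^ n * exp (INR n * t))) with (C * exp (INR n * t)) by (field; lra).
    assert (Hp := Rabs_pos (V t x)). nra.
Qed.

(** * Sine polynomials *)

Definition sine_sum (d : nat -> R) (M : nat) (x : R) : R :=
  sum_f_R0 (fun k => d k * sin (INR (S k) * x)) M.

(** The coefficients vanish from [M] on, so that two sine polynomials can be
    padded to a common length. *)
Definition sine_poly (f : R -> R) : Prop :=
  exists d M, (forall k, (M <= k)%nat -> d k = 0) /\ forall x, f x = sine_sum d M x.

Lemma sine_sum_pad d M M' x : (M <= M')%nat -> (forall k, (M <= k)%nat -> d k = 0) ->
  sine_sum d M' x = sine_sum d M x.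
Proof.
intros HM Hd. induction HM as [|M' HM IH]; [easy|].
unfold sine_sum in *. rewrite tech5, IH, Hd by lia. ring.
Qed.

Lemma sine_poly_ext f g : (forall x, f x = g x) -> sine_poly f -> sine_poly g.
Proof. intros E [d [M [H H']]]. exists d, M; split; [easy|]. intros x; now rewrite <- E. Qed.

Lemma sine_poly_plus f g : sine_poly f -> sine_poly g -> sine_poly (fun x => f x + g x).
Proof.
intros [d [M [Hd Hf]]] [d' [M' [Hd' Hg]]].
exists (fun k => d k + d' k), (Nat.max M M'); split.
- intros k Hk. rewrite Hd, Hd' by lia. ring.
- intros x. rewrite Hf, Hg.
  rewrite <- (sine_sum_pad d M (Nat.max M M')) by (auto; lia).
  rewrite <- (sine_sum_pad d' M' (Nat.max M M')) by (auto; lia).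
  unfold sine_sum. rewrite <- plus_sum. apply sum_eq. intros; ring.
Qed.

Lemma sine_poly_scal c f : sine_poly f -> sine_poly (fun x => c * f x).
Proof.
intros [d [M [Hd Hf]]]. exists (fun k => c * d k), M; split.
- intros k Hk. rewrite Hd by easy. ring.
- intros x. rewrite Hf. unfold sine_sum. rewrite scal_sum. apply sum_eq. intros; ring.
Qed.

Lemma sine_poly_sin : sine_poly sin.
Proof.
exists (fun k => match k with O => 1 | S _ => 0 end), 1%nat; split.
- intros [|k] Hk; [lia|easy].
- intros x. unfold sine_sum. simpl. rewrite !Rmult_1_l. ring.
Qed.

Lemma sine_poly_mul_cos f : sine_poly f -> sine_poly (fun x => cos x * f x).
Proof.
intros [d [M [Hd Hf]]].
set (p := fun k => match k with O => 0 | S j => d j end).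
exists (fun k => / 2 * (d (S k) + p k)), (S M); split.
- intros k Hk. rewrite Hd by lia. destruct k as [|k]; [lia|]. simpl. rewrite Hd by lia. ring.
- intros x. rewrite Hf, <- (sine_sum_pad d M (S M)) by (auto; lia).
  assert (H : forall m, cos x * sine_sum d m x =
    sine_sum (fun k => / 2 * (d (S k) + p k)) m x + / 2 * (d m * sin (INR (S (S m)) * x)
      - d (S m) * sin (INR (S m) * x))).
  { (* 2 cos x sin (k+1)x = sin (k+2)x + sin kx, summed by parts *)
    assert (Hprod : forall k, 2 * (cos x * sin (INR (S k) * x)) = sin (INR (S (S k)) * x) + sin (INR k * x)).
    { intros k. rewrite !S_INR.
      replace ((INR k + 1 + 1) * x) with ((INR k + 1) * x + x) by ring.
      replace (INR k * x) with ((INR k + 1) * x - x) by ring.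
      rewrite sin_plus, sin_minus. ring. }
    induction m as [|m IH].
    - unfold sine_sum. simpl sum_f_R0. unfold p. assert (H := Hprod O).
      simpl INR in H |- *. rewrite Rmult_0_l, sin_0 in H. nra.
    - unfold sine_sum in *. rewrite !tech5, Rmult_plus_distr_l, IH.
      assert (H := Hprod (S m)). simpl p.
      replace (cos x * (d (S m) * sin (INR (S (S m)) * x)))
        with (d (S m) * / 2 * (2 * (cos x * sin (INR (S (S m)) * x)))) by field.
      rewrite H. field. }
  rewrite H, (Hd (S M)), (Hd (S (S M))) by lia. ring.
Qed.

(** The expectation of [f] at the number of successes in [n] independent
    trials of probability [X]: the Bernstein operator. *)
Fixpoint bernstein (n : nat) (f : nat -> R) (X : R) : R :=
  match n with
  | O => f O
  | S m => X * bernstein m (fun j => f (S j)) X + (1 - X) * bernstein m f X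
  end.

Lemma bernstein_ext n f g X : (forall j, f j = g j) -> bernstein n f X = bernstein n g X.
Proof.
revert f g; induction n as [|n IH]; intros f g E; simpl; [apply E|].
rewrite (IH f g E), (IH (fun j => f (S j)) (fun j => g (S j))); auto.
Qed.

Lemma bernstein_le n f g X : 0 <= X <= 1 -> (forall j, (j <= n)%nat -> f j <= g j) ->
  bernstein n f X <= bernstein n g X.
Proof.
intros HX. revert f g; induction n as [|n IH]; intros f g E; simpl; [apply E; lia|].
apply Rplus_le_compat; apply Rmult_le_compat_l; try lra; apply IH; intros; apply E; lia.
Qed.

(** Mean and variance of the number of successes, in the form in which they
    pass through the recursion. *)
Lemma bernstein_quadratic n a b c X :
  bernstein n (fun j => a + b * INR j + c * INR j ^ 2) X =
  a + b * (INR n * X) + c * (INR n * X * (1 - X) + (INR n * X) ^ 2).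
Proof.
revert a b c; induction n as [|n IH]; intros a b c; [simpl; ring|].
simpl bernstein.
rewrite (bernstein_ext n (fun j => a + b * INR (S j) + c * INR (S j) ^ 2)
  (fun j => (a + b + c) + (b + 2 * c) * INR j + c * INR j ^ 2)).
- rewrite !IH, S_INR. ring.
- intros j. rewrite S_INR. ring.
Qed.

(** By uniform continuity, [q (j/n)] differs from [q X] by at most a constant
    plus a multiple of [(j/n - X)^2], and the operator is positive and sends this
    quadratic function of [j] to something small. *)
Lemma bernstein_approximation (q : R -> R) :
  (forall X, 0 <= X <= 1 -> continuity_pt q X) ->
  forall eps, 0 < eps -> exists n : nat, forall X, 0 <= X <= 1 ->
    Rabs (bernstein n (fun j => q (INR j / INR n)) X - q X) <= eps.
Proof.
intros Hq eps He.
assert (HQ : exists Q, 0 <= Q /\ forall X, 0 <= X <= 1 -> Rabs (q X) <= Q).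
{ destruct (continuity_ab_maj (fun X => Rabs (q X)) 0 1) as [Xm [Hm HXm]]; [lra| |].
  - intros X HX. apply (continuity_pt_comp q Rabs); [now apply Hq|apply Rcontinuity_abs].
  - exists (Rabs (q Xm)); split; [apply Rabs_pos|auto]. }
destruct HQ as [Q [HQ0 HQ]].
destruct (Heine_cor1 Rlt_0_1 Hq (mkposreal (eps / 2) ltac:(lra))) as [del [_ Hdel]].
simpl in Hdel. assert (Hd0 := cond_pos del). set (dl := pos del) in *.
set (k := 2 * Q / dl ^ 2).
assert (Hd2 : 0 < dl ^ 2) by now apply pow_lt.
assert (Hk : 0 <= k).
{ unfold k, Rdiv. apply Rmult_le_pos; [lra|]. left. now apply Rinv_0_lt_compat. }
destruct (INR_unbounded (k / eps)) as [n0 Hn0].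
set (n := S n0). exists n. intros X HX.
assert (Hn : k / eps < INR n) by (unfold n; rewrite S_INR; lra).
assert (Hnp : 0 < INR n) by (apply lt_0_INR; unfold n; lia).
assert (Hkn : k / INR n <= eps).
{ apply Rmult_le_reg_r with (INR n); [easy|].
  replace (k / INR n * INR n) with k by (field; lra).
  apply Rmult_lt_compat_r with (r := eps) in Hn; [|easy].
  replace (k / eps * eps) with k in Hn by (field; lra). lra. }
assert (Hnode : forall j, (j <= n)%nat ->
  Rabs (q (INR j / INR n) - q X) <= eps / 2 + k * (INR j / INR n - X) ^ 2).
{ intros j Hj. set (Y := INR j / INR n).
  assert (HY : 0 <= Y <= 1).
  { unfold Y. assert (0 <= INR j <= INR n) by (split; [apply pos_INR|now apply le_INR]).
    split; apply Rmult_le_reg_r with (INR n); try easy;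
    replace (INR j / INR n * INR n) with (INR j) by (field; lra); lra. }
  assert (Hsq := pow2_ge_0 (Y - X)).
  destruct (Rlt_dec (Rabs (Y - X)) dl) as [Hlt|Hge].
  - specialize (Hdel Y X HY HX Hlt). nra.
  - assert (dl ^ 2 <= (Y - X) ^ 2).
    { rewrite <- (pow2_abs (Y - X)). apply pow_incr. lra. }
    assert (2 * Q <= k * (Y - X) ^ 2).
    { unfold k. replace (2 * Q) with (2 * Q / dl ^ 2 * dl ^ 2) at 1 by (field; lra).
      apply Rmult_le_compat_l; easy. }
    assert (G1 := HQ Y HY). assert (G2 := HQ X HX).
    apply Rle_trans with (1 := Rabs_triang (q Y) (- q X)). rewrite Rabs_Ropp. lra. }
assert (Hquad : forall sg, bernstein n (fun j => q X + sg * (eps / 2 + k * (INR j / INR n - X) ^ 2)) X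
   = q X + sg * (eps / 2 + k / INR n * (X * (1 - X)))).
{ intros sg. rewrite (bernstein_ext n _ (fun j => (q X + sg * (eps / 2 + k * X ^ 2)) +
    (- (2 * sg * k * X / INR n)) * INR j + (sg * k / INR n ^ 2) * INR j ^ 2)).
  - rewrite bernstein_quadratic. field. lra.
  - intros j. field. lra. }
assert (HXX : 0 <= X * (1 - X) <= / 2) by nra.
assert (Hkn0 : 0 <= k / INR n).
{ unfold Rdiv. apply Rmult_le_pos; [easy|]. left; now apply Rinv_0_lt_compat. }
apply Rabs_le. split.
- assert (H := bernstein_le n (fun j => q X + -1 * (eps / 2 + k * (INR j / INR n - X) ^ 2))
    (fun j => q (INR j / INR n)) X HX). rewrite Hquad in H.
  assert (q X + -1 * (eps / 2 + k / INR n * (X * (1 - X))) <= bernstein n (fun j => q (INR j / INR n)) X).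
  { apply H. intros j Hj. specialize (Hnode j Hj). apply Rabs_le_between in Hnode. lra. }
  nra.
- assert (H := bernstein_le n (fun j => q (INR j / INR n))
    (fun j => q X + 1 * (eps / 2 + k * (INR j / INR n - X) ^ 2)) X HX). rewrite Hquad in H.
  assert (bernstein n (fun j => q (INR j / INR n)) X <= q X + 1 * (eps / 2 + k / INR n * (X * (1 - X)))).
  { apply H. intros j Hj. specialize (Hnode j Hj). apply Rabs_le_between in Hnode. lra. }
  nra.
Qed.

Lemma sine_poly_bernstein n f : sine_poly (fun x => sin x * bernstein n f ((1 - cos x) / 2)).
Proof.
revert f; induction n as [|n IH]; intros f; simpl.
- apply (sine_poly_ext (fun x => f O * sin x)); [intros; ring|].
  apply sine_poly_scal, sine_poly_sin.
- set (F := fun x => sin x * bernstein n (fun j => f (S j)) ((1 - cos x) / 2)).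
  set (G := fun x => sin x * bernstein n f ((1 - cos x) / 2)).
  assert (HF : sine_poly F) by apply IH. assert (HG : sine_poly G) by apply IH.
  apply (sine_poly_ext (fun x => / 2 * (F x + -1 * (cos x * F x)) + / 2 * (G x + cos x * G x))).
  + intros x. unfold F, G. field.
  + clearbody F G.
    apply sine_poly_plus; apply sine_poly_scal; apply sine_poly_plus; try easy.
    * now apply sine_poly_scal, sine_poly_mul_cos.
    * now apply sine_poly_mul_cos.
Qed.

(** Since [h] vanishes near the ends, [h / sin] is a continuous function of
    [cos x]; multiplying its polynomial approximations by [sin x] gives sine
    polynomials. *)
Lemma sine_poly_dense (h : R -> R) (eta : R) : 0 < eta < PI / 2 ->
  (forall x, 0 < x < PI -> continuity_pt h x) ->
  (forall x, 0 <= x < eta -> h x = 0) -> (forall x, PI - eta < x <= PI -> h x = 0) ->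
  forall eps, 0 < eps -> exists S, sine_poly S /\
    forall x, 0 <= x <= PI -> Rabs (h x - S x) <= eps.
Proof.
intros Heta Hh H0 Hpi eps He.
set (q := fun X => h (acos (1 - 2 * X)) * / sin (acos (1 - 2 * X))).
assert (Hcos : 0 < cos eta < 1).
{ split; [apply cos_gt_0; lra|]. rewrite <- cos_0. apply cos_decreasing_1; lra. }
assert (Hnear0 : forall Y, cos eta < Y -> h (acos Y) = 0).
{ intros Y HY. apply H0. assert (Hb := acos_bound Y). split; [lra|].
  apply Rnot_le_lt; intros Hle.
  destruct (Rle_dec 1 Y) as [H1|H1].
  { unfold acos in Hle. destruct Rle_dec; [lra|]. destruct Rle_dec; lra. }
  assert (cos (acos Y) <= cos eta) by (apply cos_decr_1; lra).
  rewrite cos_acos in H by lra. lra. }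
assert (Hnearpi : forall Y, Y < - cos eta -> h (acos Y) = 0).
{ intros Y HY. apply Hpi. assert (Hb := acos_bound Y). split; [|lra].
  apply Rnot_le_lt; intros Hle.
  destruct (Rle_dec Y (-1)) as [H1|H1].
  { unfold acos in Hle. destruct Rle_dec; lra. }
  assert (cos (PI - eta) <= cos (acos Y)) by (apply cos_decr_1; lra).
  rewrite cos_acos in H by lra.
  rewrite cos_minus, cos_PI, sin_PI in H. lra. }
assert (Hq : forall X, 0 <= X <= 1 -> continuity_pt q X).
{ intros X HX.
  assert (Hloc0 : forall d, 0 < d -> (forall Y, Rabs (Y - X) < d -> q Y = 0) -> continuity_pt q X).
  { intros d Hd Hz. apply continuity_pt_locally. intros e. exists (mkposreal d Hd).
    intros Y HY. change (Rabs (Y - X) < d) in HY.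
    rewrite (Hz Y HY), (Hz X).
    - rewrite Rminus_0_r, Rabs_R0. apply cond_pos.
    - rewrite Rminus_diag, Rabs_R0. easy. }
  destruct (Rlt_dec (cos eta) (1 - 2 * X)) as [Hl|Hl].
  { apply (Hloc0 ((1 - 2 * X - cos eta) / 2)); [lra|]. intros Y HY. apply Rabs_def2 in HY.
    unfold q. rewrite Hnear0 by lra. ring. }
  destruct (Rlt_dec (1 - 2 * X) (- cos eta)) as [Hr|Hr].
  { apply (Hloc0 ((- cos eta - (1 - 2 * X)) / 2)); [lra|]. intros Y HY. apply Rabs_def2 in HY.
    unfold q. rewrite Hnearpi by lra. ring. }
  assert (Hin : 0 < acos (1 - 2 * X) < PI).
  { assert (Hb := acos_bound (1 - 2 * X)).
    assert (Hca := cos_acos (1 - 2 * X) ltac:(lra)).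
    split; apply Rnot_le_lt; intros Hle.
    - replace (acos (1 - 2 * X)) with 0 in Hca by lra. rewrite cos_0 in Hca. lra.
    - replace (acos (1 - 2 * X)) with PI in Hca by lra. rewrite cos_PI in Hca. lra. }
  assert (Hac : continuity_pt (fun X => acos (1 - 2 * X)) X).
  { apply (continuity_pt_comp (fun X => 1 - 2 * X) acos).
    - apply continuity_pt_filterlim. apply (ex_derive_continuous (fun X => 1 - 2 * X)). now auto_derive.
    - apply derivable_continuous_pt. apply derivable_pt_acos. lra. }
  unfold q. apply continuity_pt_mult.
  - apply (continuity_pt_comp (fun X => acos (1 - 2 * X)) h); [easy|now apply Hh].
  - apply continuity_pt_inv.
    + apply (continuity_pt_comp (fun X => acos (1 - 2 * X)) sin); [easy|apply continuity_sin].
    + assert (0 < sin (acos (1 - 2 * X))) by (apply sin_gt_0; lra). lra. }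
destruct (bernstein_approximation q Hq eps He) as [n Hn].
exists (fun x => sin x * bernstein n (fun j => q (INR j / INR n)) ((1 - cos x) / 2)).
split; [apply sine_poly_bernstein|]. intros x Hx.
assert (Hcx := COS_bound x).
specialize (Hn ((1 - cos x) / 2) ltac:(lra)).
assert (Hqx : h x = sin x * q ((1 - cos x) / 2)).
{ unfold q. replace (1 - 2 * ((1 - cos x) / 2)) with (cos x) by field.
  rewrite acos_cos by easy.
  destruct (Req_dec (sin x) 0) as [Hs|Hs]; [|field; easy].
  rewrite Hs, Rmult_0_l.
  destruct (Rle_dec x 0) as [Hx0|Hx0]; [apply H0; lra|].
  destruct (Rle_dec PI x) as [Hx1|Hx1]; [apply Hpi; lra|].
  assert (0 < sin x) by (apply sin_gt_0; lra). lra. }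
rewrite Hqx, <- Rmult_minus_distr_l, Rabs_mult, Rabs_minus_sym.
assert (Rabs (sin x) <= 1) by (apply Rabs_le; apply SIN_bound).
assert (H1 := Rabs_pos (sin x)).
assert (H2 := Rabs_pos (bernstein n (fun j => q (INR j / INR n)) ((1 - cos x) / 2) - q ((1 - cos x) / 2))).
nra.
Qed.

(** * Coefficient estimates *)

Lemma sin_INR_PI k : sin (INR k * PI) = 0.
Proof.
induction k as [|k IH]; [simpl; rewrite Rmult_0_l; apply sin_0|].
rewrite S_INR, Rmult_plus_distr_r, Rmult_1_l, sin_plus, IH, sin_PI. ring.
Qed.

Lemma is_RInt_sin_sin (j k : nat) :
  is_RInt (fun x => sin (INR (S k) * x) * sin (INR (S j) * x)) 0 PI
    (if Nat.eq_dec k j then PI / 2 else 0).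
Proof.
assert (Ha : 0 < INR (S k)) by (apply lt_0_INR; lia).
assert (Hb : 0 < INR (S j)) by (apply lt_0_INR; lia).
destruct (Nat.eq_dec k j) as [->|Hne].
- set (a := INR (S j)) in *.
  evar_last.
  + apply (is_RInt_derive (fun x => x / 2 - sin (a * x) * cos (a * x) / (2 * a))).
    * intros x _. auto_derive; [easy|].
      assert (H := sin2_cos2 (a * x)). unfold Rsqr in H. field_simplify; [|lra].
      replace (cos (a * x) ^ 2) with (1 - sin (a * x) ^ 2) by nra. field. lra.
    * intros x _. apply (ex_derive_continuous (fun x => sin (a * x) * sin (a * x))). now auto_derive.
  + unfold minus, plus, opp; simpl. unfold a.
    rewrite sin_INR_PI, Rmult_0_r, sin_0. field. fold a. lra.
- set (a := INR (S k)) in *. set (b := INR (S j)) in *.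
  assert (Hab : a - b <> 0).
  { unfold a, b. intros E. apply Hne. assert (INR (S k) = INR (S j)) by lra. apply INR_eq in H. lia. }
  evar_last.
  + apply (is_RInt_derive (fun x => sin ((a - b) * x) / (2 * (a - b)) - sin ((a + b) * x) / (2 * (a + b)))).
    * intros x _. auto_derive; [easy|].
      replace ((a - b) * x) with (a * x - b * x) by ring.
      replace ((a + b) * x) with (a * x + b * x) by ring.
      rewrite cos_minus, cos_plus. field. lra.
    * intros x _. apply (ex_derive_continuous (fun x => sin (a * x) * sin (b * x))). now auto_derive.
  + unfold minus, plus, opp; simpl.
    rewrite !Rmult_0_r, sin_0.
    replace ((a - b) * PI) with (a * PI - b * PI) by ring.
    replace ((a + b) * PI) with (a * PI + b * PI) by ring.
    rewrite sin_minus, sin_plus. unfold a, b. rewrite !sin_INR_PI. fold a b. field. lra.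
Qed.

(** Each coefficient is recovered by integrating against the corresponding
    sine over [[0, PI]]. *)
Lemma sine_sum_coef_bound d M B :
  (forall x, 0 <= x <= PI -> Rabs (sine_sum d M x) <= B) ->
  forall j, (j <= M)%nat -> Rabs (d j) <= 2 * B.
Proof.
intros HB j Hj.
assert (Hint : forall m, is_RInt (fun x => sine_sum d m x * sin (INR (S j) * x)) 0 PI
   (if le_dec j m then d j * (PI / 2) else 0)).
{ induction m as [|m IH].
  - evar_last.
    + apply (is_RInt_ext (fun x => scal (d O) (sin (INR 1 * x) * sin (INR (S j) * x)))).
      * intros x _. unfold sine_sum, sum_f_R0. symmetry. apply Rmult_assoc.
      * apply (is_RInt_scal (V := R_NormedModule)). apply (is_RInt_sin_sin j 0).
    + change (d O * (if Nat.eq_dec 0 j then PI / 2 else 0) = if le_dec j 0 then d j * (PI / 2) else 0).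
      destruct (Nat.eq_dec 0 j) as [<-|]; destruct le_dec; try lia; ring.
  - evar_last.
    + apply (is_RInt_ext (fun x => plus (sine_sum d m x * sin (INR (S j) * x))
        (scal (d (S m)) (sin (INR (S (S m)) * x) * sin (INR (S j) * x))))).
      * intros x _. unfold sine_sum at 2. rewrite tech5, Rmult_plus_distr_r, Rmult_assoc. reflexivity.
      * apply (is_RInt_plus (V := R_NormedModule)); [exact IH|].
        apply (is_RInt_scal (V := R_NormedModule)). apply (is_RInt_sin_sin j (S m)).
    + change ((if le_dec j m then d j * (PI / 2) else 0) + d (S m) * (if Nat.eq_dec (S m) j then PI / 2 else 0)
        = if le_dec j (S m) then d j * (PI / 2) else 0).
      destruct (Nat.eq_dec (S m) j) as [<-|]; repeat destruct le_dec; try lia; ring. }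
specialize (Hint M). destruct (le_dec j M) as [_|]; [|easy].
assert (Hpi := PI_RGT_0).
assert (Hprod : forall x, 0 <= x <= PI -> Rabs (sine_sum d M x * sin (INR (S j) * x)) <= B).
{ intros x Hx. rewrite Rabs_mult. specialize (HB x Hx).
  assert (Rabs (sin (INR (S j) * x)) <= 1) by (apply Rabs_le; apply SIN_bound).
  assert (H1 := Rabs_pos (sine_sum d M x)). assert (H2 := Rabs_pos (sin (INR (S j) * x))). nra. }
assert (Hn := norm_RInt_le_const (V := R_NormedModule) (fun x => sine_sum d M x * sin (INR (S j) * x)) 0 PI _ B ltac:(lra) Hprod Hint).
change (Rabs (d j * (PI / 2)) <= (PI - 0) * B) in Hn.
rewrite Rabs_mult, (Rabs_pos_eq (PI / 2)) in Hn by lra. nra.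
Qed.

(** A polynomial without constant term is determined, with a bound, by its values at
    [1, 2, 4, ..., 2^n]; the power [(2^(k+1))^j] is the monomial of degree [k+1]
    at [2^j]. *)
Lemma geometric_sampling (n : nat) : exists L, 0 < L /\ forall b B,
  (forall j, (j <= n)%nat -> Rabs (sum_f_R0 (fun k => b k * (2 ^ S k) ^ j) n) <= B) ->
  forall k, (k <= n)%nat -> Rabs (b k) <= L * B.
Proof.
induction n as [|n [L [HL IH]]].
- exists 1; split; [lra|]. intros b B H k Hk. replace k with O by lia.
  specialize (H O (le_n 0)). simpl in H. rewrite Rmult_1_r in H. lra.
- set (L' := L * (1 + 2 ^ S (S n))).
  assert (HP : 0 < 2 ^ S (S n)) by (apply pow_lt; lra).
  assert (HL' : 0 < L') by (unfold L'; apply Rmult_lt_0_compat; lra).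
  exists (1 + INR (S n) * L' + L').
  assert (HIN := pos_INR (S n)).
  assert (HIL : 0 <= INR (S n) * L') by (apply Rmult_le_pos; lra).
  split; [lra|]. intros b B H.
  assert (HB : 0 <= B).
  { apply Rle_trans with (2 := H O ltac:(lia)). apply Rabs_pos. }
  (* the combination of two consecutive samples that eliminates the top mode *)
  assert (Hlow : forall k, (k <= n)%nat -> Rabs (b k) <= L' * B).
  { intros k Hk.
    assert (G : Rabs (b k * (2 ^ S k - 2 ^ S (S n))) <= L * ((1 + 2 ^ S (S n)) * B)).
    { apply (IH (fun k => b k * (2 ^ S k - 2 ^ S (S n)))); [|easy]. intros j Hj.
      replace (sum_f_R0 (fun k0 => b k0 * (2 ^ S k0 - 2 ^ S (S n)) * (2 ^ S k0) ^ j) n) with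
        (sum_f_R0 (fun k => b k * (2 ^ S k) ^ (S j)) (S n) -
          2 ^ S (S n) * sum_f_R0 (fun k => b k * (2 ^ S k) ^ j) (S n)).
      - apply Rle_trans with (1 := Rabs_triang _ _). rewrite Rabs_Ropp, Rabs_mult.
        rewrite (Rabs_pos_eq (2 ^ S (S n))) by lra.
        assert (H1 := H (S j) ltac:(lia)). assert (H2 := H j ltac:(lia)). nra.
      - rewrite scal_sum, <- minus_sum, tech5.
        replace (b (S n) * (2 ^ S (S n)) ^ S j - b (S n) * (2 ^ S (S n)) ^ j * 2 ^ S (S n)) with 0
          by (rewrite <- (tech_pow_Rmult _ j); ring).
        rewrite Rplus_0_r. apply sum_eq. intros i Hi. rewrite <- (tech_pow_Rmult _ j). ring. }
    rewrite Rabs_mult in G.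
    assert (Hgap : 1 <= Rabs (2 ^ S k - 2 ^ S (S n))).
    { assert (2 ^ S k <= 2 ^ S n) by (apply Rle_pow; [lra|lia]).
      assert (1 <= 2 ^ S n) by (apply pow_R1_Rle; lra).
      rewrite <- (tech_pow_Rmult 2 (S n)). rewrite Rabs_left1; lra. }
    assert (Hb := Rabs_pos (b k)). unfold L'. nra. }
  intros k Hk. destruct (Nat.eq_dec k (S n)) as [->|Hne].
  + assert (H0 := H O ltac:(lia)). rewrite tech5 in H0. simpl pow in H0. rewrite Rmult_1_r in H0.
    assert (Hs : Rabs (sum_f_R0 (fun k => b k * 1) n) <= INR (S n) * (L' * B)).
    { apply Rle_trans with (sum_f_R0 (fun k => Rabs (b k * 1)) n); [apply Rsum_abs|].
      rewrite (Rmult_comm (INR (S n))), <- sum_cte. apply sum_Rle.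
      intros i Hi. rewrite Rmult_1_r. now apply Hlow. }
    assert (Rabs (b (S n)) <= B + INR (S n) * (L' * B)).
    { apply Rabs_le_between in Hs. apply Rabs_le_between in H0. apply Rabs_le. lra. }
    nra.
  + specialize (Hlow k ltac:(lia)). nra.
Qed.

Lemma geometric_tail (a : nat -> R) (Q y : R) (p M : nat) : (p <= M)%nat -> 0 <= Q -> 0 <= y <= / 2 ->
  (forall k, (k <= M)%nat -> Rabs (a k) <= Q * y ^ S k) ->
  Rabs (sum_f_R0 a M - sum_f_R0 a p) <= 2 * Q * y ^ S (S p).
Proof.
intros HM HQ Hy Ha.
enough (H : Rabs (sum_f_R0 a M - sum_f_R0 a p) <= 2 * Q * (y ^ S (S p) - y ^ S (S M))).
{ assert (0 <= Q * y ^ S (S M)) by (apply Rmult_le_pos; [easy|now apply pow_le]). lra. }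
induction HM as [|M HM IH].
- rewrite !Rminus_diag, Rabs_R0. lra.
- specialize (IH (fun k Hk => Ha k ltac:(lia))). specialize (Ha (S M) (le_n _)).
  rewrite tech5. rewrite <- (tech_pow_Rmult y (S (S M))).
  assert (H0 : 0 <= Q * y ^ S (S M)) by (apply Rmult_le_pos; [easy|now apply pow_le]).
  replace (sum_f_R0 a M + a (S M) - sum_f_R0 a p) with ((sum_f_R0 a M - sum_f_R0 a p) + a (S M)) by ring.
  apply Rle_trans with (1 := Rabs_triang _ _). nra.
Qed.

(** * Modes and the comparison function *)

Lemma is_second_derive_exp (k x : R) : is_second_derive (fun s => exp (k * s)) x (k * k * exp (k * x)).
Proof.
exists (fun s => k * exp (k * s)); split.
- apply filter_forall. intros y. auto_derive; [easy|ring].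
- auto_derive; [easy|ring].
Qed.

Lemma is_second_derive_sin (k x : R) : is_second_derive (fun s => sin (k * s)) x (- (k * k * sin (k * x))).
Proof.
exists (fun s => k * cos (k * s)); split.
- apply filter_forall. intros y. auto_derive; [easy|ring].
- auto_derive; [easy|ring].
Qed.

(** In the sector, [e^{(k+1)t} sin((k+1)x)] is a multiple of the singular
    harmonic function [|z|^{-2(k+1)} sin(2(k+1) arg z)]. *)
Definition modes (c : nat -> R) (M : nat) (t x : R) : R :=
  sum_f_R0 (fun k => c k * exp (INR (S k) * t) * sin (INR (S k) * x)) M.

Lemma modes_harmonic c M t x : laplacian_at (modes c M) t x 0.
Proof.
assert (Hone : forall k, laplacian_at (fun t x => c k * exp (INR (S k) * t) * sin (INR (S k) * x)) t x 0).
{ intros k. set (m := INR (S k)).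
  exists (c k * sin (m * x) * (m * m * exp (m * t))), (c k * exp (m * t) * (- (m * m * sin (m * x)))).
  split; [|split; [|ring]].
  - apply (is_second_derive_ext (fun s => c k * sin (m * x) * exp (m * s))); [intros; ring|].
    apply is_second_derive_scal, is_second_derive_exp.
  - apply (is_second_derive_scal (fun y => sin (m * y)) x _ (c k * exp (m * t))), is_second_derive_sin. }
induction M as [|M IH]; [apply Hone|].
replace 0 with (0 + 0) by ring.
apply (laplacian_at_plus (modes c M)
  (fun t x => c (S M) * exp (INR (S (S M)) * t) * sin (INR (S (S M)) * x)) t x 0 0 IH (Hone (S M))).
Qed.

Lemma continuity_2d_pt_product (g h : R -> R) t x :
  (forall y, ex_derive g y) -> (forall y, ex_derive h y) ->
  continuity_2d_pt (fun s y => g s * h y) t x.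
Proof.
intros Hg Hh. apply continuity_2d_pt_mult.
- apply (continuity_1d_2d_pt_comp g (fun s _ => s)); [|apply continuity_2d_pt_id1].
  apply continuity_pt_filterlim. apply (ex_derive_continuous g), Hg.
- apply (continuity_1d_2d_pt_comp h (fun _ y => y)); [|apply continuity_2d_pt_id2].
  apply continuity_pt_filterlim. apply (ex_derive_continuous h), Hh.
Qed.

Lemma modes_continuous c M t x : continuity_2d_pt (modes c M) t x.
Proof.
assert (Hone : forall k, continuity_2d_pt (fun t x => c k * exp (INR (S k) * t) * sin (INR (S k) * x)) t x).
{ intros k. apply (continuity_2d_pt_product (fun t => c k * exp (INR (S k) * t)) (fun x => sin (INR (S k) * x)));
  intros y; now auto_derive. }
induction M as [|M IH]; [apply Hone|].
apply (continuity_2d_pt_plus (modes c M)); [easy|apply Hone].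
Qed.

(** For [al = be] this would be harmonic; [al < be] makes it strictly
    superharmonic, and [be < 1] keeps the cosine positive on [[0, PI]]. *)
Definition comparison (al be t x : R) : R := exp (al * t) * cos (be * (x - PI / 2)).

Lemma comparison_bounds al be t x : 0 <= be < 1 -> 0 <= x <= PI ->
  cos (be * (PI / 2)) * exp (al * t) <= comparison al be t x <= exp (al * t).
Proof.
intros Hbe Hx. unfold comparison. assert (HE := exp_pos (al * t)).
assert (Hc : cos (be * (PI / 2)) <= cos (be * (x - PI / 2))).
{ assert (Hpi := PI_RGT_0).
  rewrite <- (Rabs_pos_eq (be * (PI / 2))) by nra.
  assert (E : forall y, cos y = cos (Rabs y)).
  { intros y. unfold Rabs. destruct Rcase_abs; [now rewrite cos_neg|easy]. }
  rewrite <- E, (E (be * (x - PI / 2))), Rabs_mult, (Rabs_pos_eq be) by lra.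
  assert (Hax : 0 <= Rabs (x - PI / 2) <= PI / 2).
  { split; [apply Rabs_pos|]. apply Rabs_le. lra. }
  apply cos_decr_1; nra. }
assert (H1 := COS_bound (be * (x - PI / 2))). split; nra.
Qed.

Lemma comparison_superharmonic al be t x : 0 <= al < be -> be < 1 -> 0 < x < PI ->
  exists L, L < 0 /\ laplacian_at (comparison al be) t x L.
Proof.
intros Hal Hbe Hx.
exists (al * al * exp (al * t) * cos (be * (x - PI / 2)) + exp (al * t) * (- (be * be * cos (be * (x - PI / 2))))).
split.
- assert (Hc : 0 < comparison al be t x).
  { destruct (comparison_bounds al be t x ltac:(lra) ltac:(lra)) as [H _].
    apply Rlt_le_trans with (2 := H). apply Rmult_lt_0_compat; [|apply exp_pos].
    assert (Hpi := PI_RGT_0).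
    assert (0 <= be * (PI / 2)) by (apply Rmult_le_pos; lra).
    assert (0 < (1 - be) * (PI / 2)) by (apply Rmult_lt_0_compat; lra).
    apply cos_gt_0; lra. }
  unfold comparison in Hc.
  assert (H : 0 < (be * be - al * al) * (exp (al * t) * cos (be * (x - PI / 2)))).
  { apply Rmult_lt_0_compat; [nra|easy]. }
  lra.
- exists (al * al * exp (al * t) * cos (be * (x - PI / 2))), (exp (al * t) * (- (be * be * cos (be * (x - PI / 2))))).
  split; [|split; [|ring]].
  + replace (al * al * exp (al * t) * cos (be * (x - PI / 2))) with (cos (be * (x - PI / 2)) * (al * al * exp (al * t))) by ring.
    apply (is_second_derive_ext (fun s => cos (be * (x - PI / 2)) * exp (al * s))); [intros; unfold comparison; ring|].
    apply is_second_derive_scal, is_second_derive_exp.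
  + apply (is_second_derive_scal (fun y => cos (be * (y - PI / 2)))).
    exists (fun y => - (be * sin (be * (y - PI / 2)))); split.
    * apply filter_forall. intros y. auto_derive; [easy|unfold Rminus; ring].
    * auto_derive; [easy|unfold Rminus; ring].
Qed.

Lemma comparison_continuous al be t x : continuity_2d_pt (comparison al be) t x.
Proof.
apply (continuity_2d_pt_product (fun t => exp (al * t)) (fun x => cos (be * (x - PI / 2))));
intros y; now auto_derive.
Qed.

Lemma exp_le_compat a b : a <= b -> exp a <= exp b.
Proof. intros [H| ->]; [left; now apply exp_increasing|right; reflexivity]. Qed.

Lemma exp_pow (x : R) (n : nat) : exp (x * INR n) = exp x ^ n.
Proof.
induction n as [|n IH]; [simpl; rewrite Rmult_0_r; apply exp_0|].
rewrite S_INR, Rmult_plus_distr_l, Rmult_1_r, exp_plus, IH. simpl. ring.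
Qed.

(** * Expansion of V into finitely many modes *)

(** Subtracting from [g] its truncation at height [lam] costs at most [lam] and
    leaves a function that vanishes near both ends. *)
Lemma sine_approximation (g : R -> R) (lam B : R) (p : nat) :
  (forall x, 0 <= x <= PI -> forall eps, 0 < eps -> exists e, 0 < e /\
     forall x', 0 <= x' <= PI -> Rabs (x' - x) < e -> Rabs (g x' - g x) < eps) ->
  Rabs (g 0) < lam -> Rabs (g PI) < lam -> (forall x, 0 <= x <= PI -> Rabs (g x) <= B) ->
  exists d M, (p <= M)%nat /\
    (forall x, 0 <= x <= PI -> Rabs (g x - sine_sum d M x) <= lam + 1) /\
    (forall k, (k <= M)%nat -> Rabs (d k) <= 2 * (B + 1)).
Proof.
intros Hg H0 Hpi HB. assert (Hp := PI_RGT_0).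
assert (Hlam : 0 < lam) by (apply Rle_lt_trans with (2 := H0); apply Rabs_pos).
set (clamp := fun v => Rmax (- lam) (Rmin lam v)).
assert (Hcl1 : forall v, Rabs (clamp v) <= lam /\ Rabs (v - clamp v) <= Rabs v).
{ intros v. unfold clamp, Rmax, Rmin, Rabs. repeat destruct Rle_dec; repeat destruct Rcase_abs; lra. }
assert (Hcl2 : forall v, Rabs v <= lam -> v - clamp v = 0).
{ intros v Hv. apply Rabs_le_between in Hv. unfold clamp, Rmax, Rmin. repeat destruct Rle_dec; lra. }
assert (Hcl3 : forall v w, Rabs ((v - clamp v) - (w - clamp w)) <= Rabs (v - w)).
{ intros v w. unfold clamp, Rmax, Rmin, Rabs. repeat destruct Rle_dec; repeat destruct Rcase_abs; lra. }
set (h := fun x => g x - clamp (g x)).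
destruct (Hg 0 ltac:(lra) (lam - Rabs (g 0)) ltac:(lra)) as [e0 [He0 Hz0]].
destruct (Hg PI ltac:(lra) (lam - Rabs (g PI)) ltac:(lra)) as [e1 [He1 Hz1]].
set (eta := Rmin (PI / 4) (Rmin e0 e1)).
assert (Heta : 0 < eta /\ eta <= PI / 4 /\ eta <= e0 /\ eta <= e1).
{ unfold eta, Rmin; repeat destruct Rle_dec; lra. }
destruct (sine_poly_dense h eta) with (eps := 1) as [S [[d [M0 [Hd HS]]] Happ]]; [lra| | | |lra|].
- intros x Hx. apply continuity_pt_locally. intros eps.
  destruct (Hg x ltac:(lra) eps (cond_pos eps)) as [e [He H]].
  assert (Hm : 0 < Rmin e (Rmin x (PI - x))).
  { unfold Rmin; repeat destruct Rle_dec; lra. }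
  exists (mkposreal _ Hm). intros y Hy. change (Rabs (y - x) < Rmin e (Rmin x (PI - x))) in Hy.
  assert (G1 := Rmin_l e (Rmin x (PI - x))). assert (G2 := Rmin_r e (Rmin x (PI - x))).
  assert (G3 := Rmin_l x (PI - x)). assert (G4 := Rmin_r x (PI - x)).
  apply Rle_lt_trans with (1 := Hcl3 (g y) (g x)). apply H; [|lra].
  apply Rabs_def2 in Hy. lra.
- intros x Hx. apply Hcl2. specialize (Hz0 x ltac:(lra) ltac:(rewrite Rabs_pos_eq; lra)).
  assert (H := Rabs_triang (g x - g 0) (g 0)). replace (g x - g 0 + g 0) with (g x) in H by ring. lra.
- intros x Hx. apply Hcl2. specialize (Hz1 x ltac:(lra) ltac:(apply Rabs_def1; lra)).
  assert (H := Rabs_triang (g x - g PI) (g PI)). replace (g x - g PI + g PI) with (g x) in H by ring. lra.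
- exists d, (Nat.max M0 p). split; [lia|].
  assert (Happ' : forall x, 0 <= x <= PI -> Rabs (h x - sine_sum d (Nat.max M0 p) x) <= 1).
  { intros x Hx. rewrite (sine_sum_pad d M0) by (auto; lia). rewrite <- HS. auto. }
  split.
  + intros x Hx. specialize (Happ' x Hx). destruct (Hcl1 (g x)) as [H1 _].
    apply Rabs_le_between in Happ'. apply Rabs_le_between in H1. unfold h in Happ'. apply Rabs_le. lra.
  + apply sine_sum_coef_bound. intros x Hx. specialize (Happ' x Hx). specialize (HB x Hx).
    destruct (Hcl1 (g x)) as [_ H2]. fold (h x) in H2.
    assert (H := Rabs_triang (h x) (- (h x - sine_sum d (Nat.max M0 p) x))). rewrite Rabs_Ropp in H.
    replace (h x + - (h x - sine_sum d (Nat.max M0 p) x)) with (sine_sum d (Nat.max M0 p) x) in H by ring.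
    lra.
Qed.

Lemma rectangle_max_principle (V g : R -> R -> R) (T : R) : 0 < T ->
  strip_continuous V -> (forall t x, continuity_2d_pt g t x) ->
  (forall t x, 0 < t < T -> 0 < x < PI ->
     exists L, 0 < L /\ laplacian_at (fun s y => V s y + g s y) t x L) ->
  (forall x, 0 <= x <= PI -> V 0 x + g 0 x <= 0) ->
  (forall x, 0 <= x <= PI -> V T x + g T x <= 0) ->
  (forall t, 0 <= t <= T -> V t 0 + g t 0 <= 0) ->
  (forall t, 0 <= t <= T -> V t PI + g t PI <= 0) ->
  forall t x, 0 <= t <= T -> 0 <= x <= PI -> V t x + g t x <= 0.
Proof.
intros HT HV Hg Hlap H1 H2 H3 H4 t x Ht Hx.
apply (strip_max_principle V g (fun t x => 0 <= t <= T /\ 0 <= x <= PI) T); try easy.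
- apply rectangle_neighbourhood.
- intros s y [Hs Hy].
  destruct (Req_dec s 0) as [->|Hs0]; [left; auto|].
  destruct (Req_dec s T) as [->|HsT]; [left; auto|].
  destruct (Req_dec y 0) as [->|Hy0]; [left; auto|].
  destruct (Req_dec y PI) as [->|Hyp]; [left; auto|].
  right. split; [apply Hlap; lra|].
  assert (Hm : 0 < Rmin (Rmin s (T - s)) (Rmin y (PI - y))).
  { unfold Rmin; repeat destruct Rle_dec; lra. }
  exists (mkposreal _ Hm). simpl. intros s' y' Hs' Hy'.
  assert (G1 := Rmin_l (Rmin s (T - s)) (Rmin y (PI - y))).
  assert (G2 := Rmin_r (Rmin s (T - s)) (Rmin y (PI - y))).
  assert (G3 := Rmin_l s (T - s)). assert (G4 := Rmin_r s (T - s)).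
  assert (G5 := Rmin_l y (PI - y)). assert (G6 := Rmin_r y (PI - y)).
  apply Rabs_def2 in Hs'. apply Rabs_def2 in Hy'. lra.
Qed.

(** The error is in terms of the coefficients [c] themselves, which may
    depend on [T] and are not controlled yet: the bound at [t = 0], one of the
    four sides where the maximum principle compares, involves them. *)
Lemma finite_expansion (V : R -> R -> R) (p : nat) (al C D : R) :
  0 <= al < 1 -> 0 < C -> 0 < D -> strip_continuous V -> strip_harmonic V ->
  (forall t, 0 <= t -> Rabs (V t 0) <= C * exp (al * t)) ->
  (forall t, 0 <= t -> Rabs (V t PI) <= C * exp (al * t)) ->
  (forall t x, 0 <= t -> 0 <= x <= PI -> Rabs (V t x) <= D * exp (INR (S p) * t)) ->
  exists E Q, 0 < E /\ 0 < Q /\ forall T, 1 <= T -> exists c : nat -> R,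
    forall t x, 0 <= t <= T - 1 -> 0 <= x <= PI ->
      Rabs (V t x - modes c p t x) <=
        E * (1 + sum_f_R0 (fun k => Rabs (c k)) p) * exp (al * t) + Q * exp (INR (S (S p)) * t - T).
Proof.
intros Hal HC HD Hcont Hharm H0 Hpi Hgrow.
set (be := (1 + al) / 2).
assert (Hbe : al < be < 1) by (unfold be; lra).
set (kap := cos (be * (PI / 2))).
assert (HPI := PI_RGT_0).
assert (Hkap : 0 < kap).
{ assert (0 <= be * (PI / 2)) by (apply Rmult_le_pos; lra).
  assert (0 < (1 - be) * (PI / 2)) by (apply Rmult_lt_0_compat; lra).
  apply cos_gt_0; lra. }
set (D2 := 2 * (D + 1)).
set (F := C + 3 + D + 2 * D2).
assert (HD2 : 0 < D2) by (unfold D2; lra).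
assert (HF : 0 < F) by (unfold F; lra).
exists (F / kap), (2 * D2). split; [now apply Rdiv_lt_0_compat|]. split; [lra|].
intros T HT.
assert (HexT : forall k s, 0 <= k -> 0 <= s -> 1 <= exp (k * s)).
{ intros k s Hk Hs. rewrite <- exp_0. apply exp_le_compat. nra. }
assert (HN := pos_INR (S p)).
assert (HeT := HexT (INR (S p)) T HN ltac:(lra)).
assert (HaT := HexT al T (proj1 Hal) ltac:(lra)).
destruct (sine_approximation (fun x => V T x) (C * exp (al * T) + 1) (D * exp (INR (S p) * T)) p)
  as [d [M [HM [Happ Hd]]]].
{ intros x Hx eps He. destruct (Hcont T x ltac:(lra) Hx eps He) as [e [He' H]].
  exists e; split; [easy|]. intros x' Hx' Hxx. apply H; try lra. rewrite Rminus_diag, Rabs_R0. easy. }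
{ specialize (H0 T ltac:(lra)). lra. }
{ specialize (Hpi T ltac:(lra)). lra. }
{ intros x Hx. apply Hgrow; lra. }
set (c := fun k => d k * exp (- (INR (S k) * T))).
exists c. set (m := sum_f_R0 (fun k => Rabs (c k)) p).
assert (Hterm : forall k t x, (k <= M)%nat ->
  Rabs (c k * exp (INR (S k) * t) * sin (INR (S k) * x)) <= D2 * exp (INR (S p) * T) * exp (t - T) ^ S k).
{ intros k t x Hk. specialize (Hd k Hk).
  rewrite !Rabs_mult. unfold c. rewrite Rabs_mult.
  rewrite (Rabs_pos_eq (exp (- _))), (Rabs_pos_eq (exp (INR (S k) * t))) by (left; apply exp_pos).
  assert (Hs : Rabs (sin (INR (S k) * x)) <= 1) by (apply Rabs_le; apply SIN_bound).
  rewrite (Rmult_assoc (Rabs (d k))), <- exp_plus.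
  rewrite <- exp_pow. replace (- (INR (S k) * T) + INR (S k) * t) with ((t - T) * INR (S k)) by ring.
  assert (Hee := exp_pos ((t - T) * INR (S k))).
  assert (Hp1 := Rabs_pos (d k)). assert (Hp2 := Rabs_pos (sin (INR (S k) * x))).
  assert (Hdk : Rabs (d k) <= D2 * exp (INR (S p) * T)) by (unfold D2; lra).
  apply Rle_trans with (Rabs (d k) * exp ((t - T) * INR (S k)) * 1).
  - apply Rmult_le_compat_l; [apply Rmult_le_pos; lra|easy].
  - rewrite Rmult_1_r. apply Rmult_le_compat_r; lra. }
assert (Htail : forall t x, t <= T - 1 ->
  Rabs (modes c M t x - modes c p t x) <= 2 * D2 * exp (INR (S (S p)) * t - T)).
{ intros t x Ht.
  replace (2 * D2 * exp (INR (S (S p)) * t - T)) with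
    (2 * (D2 * exp (INR (S p) * T)) * exp (t - T) ^ S (S p)).
  - apply geometric_tail; [easy| | |].
    + apply Rmult_le_pos; [lra|left; apply exp_pos].
    + split; [left; apply exp_pos|].
      apply Rle_trans with (exp (- (1))); [apply exp_le_compat; lra|].
      rewrite exp_Ropp. apply Rinv_le_contravar; [lra|].
      assert (H := exp_ineq1 1 ltac:(lra)). lra.
    + intros k Hk. now apply Hterm.
  - rewrite <- exp_pow. rewrite <- !Rmult_assoc, !(Rmult_assoc (2 * D2)), <- exp_plus.
    f_equal. f_equal. rewrite (S_INR (S p)). ring. }
assert (Hlow : forall x, Rabs (modes c p 0 x) <= m).
{ intros x. unfold modes. apply Rle_trans with (1 := Rsum_abs _ _). apply sum_Rle. intros k Hk.
  rewrite Rmult_0_r, exp_0, Rmult_1_r, Rabs_mult.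
  assert (Hs : Rabs (sin (INR (S k) * x)) <= 1) by (apply Rabs_le; apply SIN_bound).
  assert (H := Rabs_pos (c k)). nra. }
assert (Hm0 : 0 <= m) by (apply Rle_trans with (2 := Hlow 0); apply Rabs_pos).
set (A := F / kap * (1 + m)).
assert (HA : 0 < A) by (apply Rmult_lt_0_compat; [now apply Rdiv_lt_0_compat|lra]).
assert (HAk : forall t x y, 0 <= t -> 0 <= x <= PI -> y <= F * (1 + m) * exp (al * t) ->
   y <= A * comparison al be t x).
{ intros t x y Ht Hx Hy. destruct (comparison_bounds al be t x ltac:(lra) Hx) as [Hc _].
  fold kap in Hc. apply Rle_trans with (1 := Hy).
  replace (F * (1 + m) * exp (al * t)) with (A * (kap * exp (al * t))) by (unfold A; field; lra).
  apply Rmult_le_compat_l; lra. }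
assert (HF1 : forall a s, a <= F - 2 * D2 + m -> 1 <= s -> a * s <= F * (1 + m) * s).
{ intros a s Ha Hs. apply Rmult_le_compat_r; [lra|]. assert (1 <= F) by (unfold F; lra). nra. }
assert (Hbd : forall t x, 0 <= t <= T -> 0 <= x <= PI -> t = 0 \/ t = T \/ x = 0 \/ x = PI ->
  Rabs (V t x - modes c M t x) <= A * comparison al be t x).
{ intros t x Ht Hx Hside. apply HAk; [lra|easy|].
  assert (He1 := HexT al t (proj1 Hal) (proj1 Ht)).
  assert (Hz : (forall k, sin (INR (S k) * x) = 0) -> Rabs (V t x) <= C * exp (al * t) ->
    Rabs (V t x - modes c M t x) <= F * (1 + m) * exp (al * t)).
  { intros Hs HVx. replace (modes c M t x) with 0.
    - rewrite Rminus_0_r. apply Rle_trans with (1 := HVx). apply HF1; [unfold F; lra|easy].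
    - unfold modes. symmetry. apply sum_eq_R0. intros k Hk. rewrite Hs. ring. }
  destruct Hside as [->|[->|[->| ->]]].
  - rewrite Rmult_0_r, exp_0, Rmult_1_r.
    specialize (Hgrow 0 x ltac:(lra) Hx). rewrite Rmult_0_r, exp_0 in Hgrow.
    specialize (Htail 0 x ltac:(lra)). specialize (Hlow x).
    assert (exp (INR (S (S p)) * 0 - T) <= 1).
    { rewrite <- exp_0. apply exp_le_compat. lra. }
    assert (Htail' : Rabs (modes c M 0 x - modes c p 0 x) <= 2 * D2) by nra.
    apply Rabs_le_between in Hgrow. apply Rabs_le_between in Htail'. apply Rabs_le_between in Hlow.
    assert (D + 2 * D2 + m <= F * (1 + m)) by (assert (1 <= F) by (unfold F; lra); unfold F in *; nra).
    apply Rabs_le. lra.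
  - replace (modes c M T x) with (sine_sum d M x).
    + apply Rle_trans with (1 := Happ x Hx).
      apply Rle_trans with ((C + 2) * exp (al * T)); [lra|]. apply HF1; [unfold F; lra|easy].
    + unfold modes, sine_sum. apply sum_eq. intros k Hk. unfold c.
      rewrite (Rmult_assoc (d k)), <- exp_plus.
      replace (- (INR (S k) * T) + INR (S k) * T) with 0 by ring. rewrite exp_0. ring.
  - apply Hz; [|apply H0; lra]. intros k. rewrite Rmult_0_r. apply sin_0.
  - apply Hz; [|apply Hpi; lra]. intros k. apply sin_INR_PI. }
assert (Hcmp : forall t x, 0 <= t <= T -> 0 <= x <= PI ->
   Rabs (V t x - modes c M t x) <= A * comparison al be t x).
{ assert (Hlap : forall sg t x, 0 < x < PI -> exists L, 0 < L /\
    laplacian_at (fun s y => sg * modes c M s y + - A * comparison al be s y) t x L).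
  { intros sg t x Hx. destruct (comparison_superharmonic al be t x ltac:(lra) ltac:(lra) Hx) as [L [HL HLap]].
    exists (sg * 0 + - A * L). split; [nra|].
    apply (laplacian_at_plus (fun s y => sg * modes c M s y)).
    - apply laplacian_at_scal, modes_harmonic.
    - now apply laplacian_at_scal. }
  assert (Hgc : forall sg t x, continuity_2d_pt (fun s y => sg * modes c M s y + - A * comparison al be s y) t x).
  { intros sg t x. apply continuity_2d_pt_plus; apply continuity_2d_pt_mult; try apply continuity_2d_pt_const.
    - apply modes_continuous.
    - apply comparison_continuous. }
  assert (Hside : forall W sg, strip_continuous W -> strip_harmonic W ->
    (forall t x, 0 <= t <= T -> 0 <= x <= PI -> t = 0 \/ t = T \/ x = 0 \/ x = PI ->
       W t x + sg * modes c M t x <= A * comparison al be t x) ->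
    forall t x, 0 <= t <= T -> 0 <= x <= PI -> W t x + sg * modes c M t x <= A * comparison al be t x).
  { intros W sg HWc HWh HWb t x Ht Hx.
    enough (W t x + (sg * modes c M t x + - A * comparison al be t x) <= 0) by lra.
    apply (rectangle_max_principle W (fun s y => sg * modes c M s y + - A * comparison al be s y) T); try easy.
    - lra.
    - intros s y Hs Hy. destruct (Hlap sg s y Hy) as [L [HL HH]].
      exists (0 + L); split; [lra|]. apply laplacian_at_plus; [apply HWh; lra|easy].
    - intros y Hy. specialize (HWb 0 y ltac:(lra) Hy ltac:(tauto)). lra.
    - intros y Hy. specialize (HWb T y ltac:(lra) Hy ltac:(tauto)). lra.
    - intros s Hs. specialize (HWb s 0 Hs ltac:(lra) ltac:(tauto)). lra.
    - intros s Hs. specialize (HWb s PI Hs ltac:(lra) ltac:(tauto)). lra. }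
  intros t x Ht Hx. apply Rabs_le. split.
  - enough (- V t x + 1 * modes c M t x <= A * comparison al be t x) by lra.
    apply (Hside (fun t x => - V t x)); [now apply strip_continuous_opp|now apply strip_harmonic_opp| |easy|easy].
    intros s y Hs Hy Hsd. specialize (Hbd s y Hs Hy Hsd). apply Rabs_le_between in Hbd. lra.
  - enough (V t x + -1 * modes c M t x <= A * comparison al be t x) by lra.
    apply (Hside V); [easy|easy| |easy|easy].
    intros s y Hs Hy Hsd. specialize (Hbd s y Hs Hy Hsd). apply Rabs_le_between in Hbd. lra. }
intros t x Ht Hx.
specialize (Hcmp t x ltac:(lra) Hx). specialize (Htail t x ltac:(lra)).
destruct (comparison_bounds al be t x ltac:(lra) Hx) as [_ Hup].
assert (A * comparison al be t x <= A * exp (al * t)) by (apply Rmult_le_compat_l; lra).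
fold A. apply Rabs_le_between in Hcmp. apply Rabs_le_between in Htail. apply Rabs_le. lra.
Qed.

(** * Boundedness in the half-strip *)

Lemma exp_decay a W eps : 0 < a -> 0 < W -> 0 < eps ->
  exists t0, 0 <= t0 /\ forall t, t0 <= t -> W * exp (- (a * t)) <= eps.
Proof.
intros Ha HW He.
set (t0 := W / eps / a).
assert (Ht0 : 0 < t0) by (unfold t0; repeat apply Rdiv_lt_0_compat; lra).
exists t0; split; [lra|]. intros t Ht.
assert (Hat : W / eps <= a * t).
{ replace (W / eps) with (a * t0) by (unfold t0; field; lra). nra. }
assert (Hx : W / eps <= exp (a * t)).
{ apply Rle_trans with (1 + a * t); [lra|]. left. apply exp_ineq1. nra. }
rewrite exp_Ropp. assert (Hp := exp_pos (a * t)).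
apply Rmult_le_reg_r with (exp (a * t)); [easy|].
replace (W * / exp (a * t) * exp (a * t)) with W by (field; lra).
replace W with (eps * (W / eps)) by (field; lra). nra.
Qed.

Lemma finite_positive_lower_bound (f : nat -> R) n : (forall k, 0 < f k) ->
  exists s, 0 < s /\ forall k, (k <= n)%nat -> s <= f k.
Proof.
intros Hf. induction n as [|n [s [Hs IH]]].
- exists (f O). split; [easy|]. intros k Hk. replace k with O by lia. lra.
- exists (Rmin s (f (S n))). split; [apply Rmin_pos; auto|]. intros k Hk.
  assert (H1 := Rmin_l s (f (S n))). assert (H2 := Rmin_r s (f (S n))).
  destruct (Nat.eq_dec k (S n)) as [->|]; [easy|]. specialize (IH k ltac:(lia)). lra.
Qed.

(** Sampling along [x = tau] at [t0 + j ln 2] bounds the sum [m] of the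
    [|c_k|] by a multiple of [(1 + m) e^{(al - 1) t0}] plus a term that vanishes
    as [T] grows. As [al < 1], a large [t0] makes the first factor small and [m]
    can be absorbed. *)
Lemma modes_coefficients_small (p : nat) (tau al F Q : R) :
  0 <= al < 1 -> 0 < F -> 0 < Q -> (forall k, sin (INR (S k) * tau) <> 0) ->
  forall eta, 0 < eta <= 1 -> exists T0, forall T c, T0 <= T ->
    (forall t, 0 <= t <= T - 1 -> Rabs (modes c p t tau) <=
       F * (1 + sum_f_R0 (fun k => Rabs (c k)) p) * exp (al * t) + Q * exp (INR (S (S p)) * t - T)) ->
    sum_f_R0 (fun k => Rabs (c k)) p <= eta.
Proof.
intros Hal HF HQ Htau eta Heta.
destruct (finite_positive_lower_bound (fun k => Rabs (sin (INR (S k) * tau))) p) as [sg [Hsg Hsin]].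
{ intros k. now apply Rabs_pos_lt. }
destruct (geometric_sampling p) as [L [HL Hsamp]].
set (G := INR (S p) * L / sg).
assert (HSp : 0 < INR (S p)) by (apply lt_0_INR; lia).
assert (HG : 0 < G) by (unfold G; apply Rdiv_lt_0_compat; [now apply Rmult_lt_0_compat|easy]).
set (w := INR p * ln 2).
assert (Hln2 : 0 < ln 2) by (rewrite <- ln_1; apply ln_increasing; lra).
assert (Hw : 0 <= w) by (apply Rmult_le_pos; [apply pos_INR|lra]).
destruct (exp_decay (1 - al) (G * F * exp (al * w)) (eta / 4)) as [t0 [Ht0 Hdec]]; [lra| |lra|].
{ apply Rmult_lt_0_compat; [now apply Rmult_lt_0_compat|apply exp_pos]. }
specialize (Hdec t0 (Rle_refl _)).
destruct (exp_decay 1 (G * exp (- t0) * Q * exp (INR (S (S p)) * (t0 + w))) (eta / 4))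
  as [T1 [HT1 HdecT]]; [lra| |lra|].
{ apply Rmult_lt_0_compat; [|apply exp_pos]. apply Rmult_lt_0_compat; [|easy].
  apply Rmult_lt_0_compat; [easy|apply exp_pos]. }
exists (Rmax T1 (t0 + w + 1)). intros T c HT Hest.
assert (HTa := Rmax_l T1 (t0 + w + 1)). assert (HTb := Rmax_r T1 (t0 + w + 1)).
specialize (HdecT T ltac:(lra)).
set (m := sum_f_R0 (fun k => Rabs (c k)) p) in *.
assert (Hm : 0 <= m) by (apply cond_pos_sum; intros; apply Rabs_pos).
set (B := F * (1 + m) * exp (al * (t0 + w)) + Q * exp (INR (S (S p)) * (t0 + w) - T)).
assert (Hb : forall k, (k <= p)%nat ->
  Rabs (c k * sin (INR (S k) * tau) * exp (INR (S k) * t0)) <= L * B).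
{ apply (Hsamp (fun k => c k * sin (INR (S k) * tau) * exp (INR (S k) * t0))). intros j Hj.
  set (t := t0 + INR j * ln 2).
  assert (Hjw : INR j * ln 2 <= w) by (apply Rmult_le_compat_r; [lra|now apply le_INR]).
  assert (Hj0 : 0 <= INR j * ln 2) by (apply Rmult_le_pos; [apply pos_INR|lra]).
  replace (sum_f_R0 _ p) with (modes c p t tau).
  - apply Rle_trans with (1 := Hest t ltac:(unfold t; lra)). unfold B.
    apply Rplus_le_compat; apply Rmult_le_compat_l.
    + apply Rmult_le_pos; lra.
    + apply exp_le_compat, Rmult_le_compat_l; unfold t; lra.
    + lra.
    + apply exp_le_compat. apply Rplus_le_compat_r, Rmult_le_compat_l; [apply pos_INR|unfold t; lra].
  - unfold modes. apply sum_eq. intros k _.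
    replace ((2 ^ S k) ^ j) with (exp (INR (S k) * (INR j * ln 2))).
    + unfold t. rewrite Rmult_plus_distr_l, exp_plus. ring.
    + replace (INR (S k) * (INR j * ln 2)) with (ln 2 * INR (S k) * INR j) by ring.
      rewrite !exp_pow, exp_ln by lra. reflexivity. }
assert (HB : 0 <= B).
{ assert (0 <= L * B) by (apply Rle_trans with (2 := Hb O ltac:(lia)); apply Rabs_pos). nra. }
assert (Hck : forall k, (k <= p)%nat -> Rabs (c k) <= L * B * exp (- t0) / sg).
{ intros k Hk. specialize (Hb k Hk). specialize (Hsin k Hk). cbv beta in Hsin.
  rewrite !Rabs_mult in Hb. rewrite (Rabs_pos_eq (exp _)) in Hb by (left; apply exp_pos).
  assert (He : exp t0 <= exp (INR (S k) * t0)).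
  { apply exp_le_compat. rewrite S_INR. assert (H := pos_INR k). nra. }
  assert (Hc := Rabs_pos (c k)). assert (He0 := exp_pos t0).
  apply Rmult_le_reg_r with (sg * exp t0); [now apply Rmult_lt_0_compat|].
  replace (L * B * exp (- t0) / sg * (sg * exp t0)) with (L * B).
  - apply Rle_trans with (2 := Hb). rewrite Rmult_assoc. apply Rmult_le_compat_l; [easy|].
    apply Rmult_le_compat; lra.
  - rewrite exp_Ropp. field. lra. }
assert (HmB : m <= G * exp (- t0) * B).
{ unfold m. apply Rle_trans with (sum_f_R0 (fun _ => L * B * exp (- t0) / sg) p).
  - apply sum_Rle. exact Hck.
  - rewrite sum_cte. unfold G. right. field. lra. }
assert (HGB : G * exp (- t0) * B = (G * F * exp (al * w)) * exp (- ((1 - al) * t0)) * (1 + m)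
   + G * exp (- t0) * Q * exp (INR (S (S p)) * (t0 + w)) * exp (- (1 * T))).
{ unfold B. replace (al * (t0 + w)) with (al * t0 + al * w) by ring.
  replace (- ((1 - al) * t0)) with (- t0 + al * t0) by ring.
  replace (INR (S (S p)) * (t0 + w) - T) with (INR (S (S p)) * (t0 + w) + - (1 * T)) by ring.
  rewrite !exp_plus. ring. }
rewrite HGB in HmB. nra.
Qed.

(** At a fixed [(t, x)] the number [T] is sent to infinity: the remaining modes
    contribute at most [m e^{nt}], where [m] tends to 0. *)
Theorem half_strip_bound (V : R -> R -> R) (n : nat) (tau al C D : R) :
  (1 <= n)%nat -> 0 <= al < 1 -> 0 < C -> 0 < D ->
  0 <= tau <= PI -> (forall k, sin (INR (S k) * tau) <> 0) ->
  strip_continuous V -> strip_harmonic V ->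
  (forall t x, 0 <= t -> x = 0 \/ x = tau \/ x = PI -> Rabs (V t x) <= C * exp (al * t)) ->
  (forall t x, 0 < t -> 0 < x < PI -> x ^ n * Rabs (V t x) <= D * exp (INR n * t)) ->
  exists E, forall t x, 0 <= t -> 0 <= x <= PI -> Rabs (V t x) <= E * exp (al * t).
Proof.
intros Hn Hal HC HD Htau Hsin Hcont Hharm Hrays Hint.
assert (HN : 1 <= INR n) by now apply (le_INR 1).
assert (Hedge : forall t x, 0 <= t -> x = 0 \/ x = PI -> Rabs (V t x) <= (C + D) * exp (INR n * t)).
{ intros t x Ht Hx. apply Rle_trans with (1 := Hrays t x Ht ltac:(tauto)).
  assert (He := exp_pos (al * t)). assert (He' := exp_le_compat (al * t) (INR n * t) ltac:(nra)). nra. }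
destruct (exponential_growth V n (C + D)) as [D' [HD' Hgrow]]; try easy; try lra.
{ intros t Ht. apply Hedge; tauto. }
{ intros t Ht. apply Hedge; tauto. }
{ intros t x Ht Hx. apply Rle_trans with (1 := Hint t x Ht Hx).
  assert (He := exp_pos (INR n * t)). nra. }
destruct n as [|p]; [lia|].
destruct (finite_expansion V p al C D' Hal HC HD' Hcont Hharm) as [E [Q [HE [HQ Hexp]]]]; try easy.
{ intros t Ht. apply Hrays; tauto. }
{ intros t Ht. apply Hrays; tauto. }
exists (2 * E + 2). intros t x Ht Hx.
assert (Hat : 1 <= exp (al * t)) by (rewrite <- exp_0; apply exp_le_compat; nra).
set (eta := exp (- (INR (S p) * t))).
assert (Heta : 0 < eta <= 1).
{ split; [apply exp_pos|]. unfold eta. rewrite <- exp_0. apply exp_le_compat. nra. }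
destruct (modes_coefficients_small p tau al (C + E) Q Hal ltac:(lra) HQ Hsin eta Heta) as [T0 HT0].
destruct (exp_decay 1 (Q * exp (INR (S (S p)) * t)) 1) as [T1 [_ HT1]]; [lra| |lra|].
{ apply Rmult_lt_0_compat; [easy|apply exp_pos]. }
set (T := Rmax (Rmax T0 T1) (t + 1)).
assert (HT : T0 <= T /\ T1 <= T /\ t + 1 <= T).
{ unfold T. assert (G1 := Rmax_l (Rmax T0 T1) (t + 1)). assert (G2 := Rmax_r (Rmax T0 T1) (t + 1)).
  assert (G3 := Rmax_l T0 T1). assert (G4 := Rmax_r T0 T1). lra. }
destruct (Hexp T ltac:(lra)) as [c Hc].
set (m := sum_f_R0 (fun k => Rabs (c k)) p) in *.
assert (Hm0 : 0 <= m) by (apply cond_pos_sum; intros; apply Rabs_pos).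
assert (Hm : m <= eta).
{ apply (HT0 T c); [lra|]. intros s Hs. fold m.
  specialize (Hc s tau Hs Htau). specialize (Hrays s tau (proj1 Hs) ltac:(tauto)).
  assert (Hes := exp_pos (al * s)).
  assert (C * exp (al * s) <= C * (1 + m) * exp (al * s)) by (apply Rmult_le_compat_r; nra).
  apply Rabs_le_between in Hc. apply Rabs_le_between in Hrays. apply Rabs_le. lra. }
specialize (Hc t x ltac:(lra) Hx).
assert (Hmodes : Rabs (modes c p t x) <= 1).
{ apply Rle_trans with (m * exp (INR (S p) * t)).
  - unfold modes. apply Rle_trans with (1 := Rsum_abs _ _). unfold m. rewrite Rmult_comm, scal_sum.
    apply sum_Rle. intros k Hk. rewrite !Rabs_mult, (Rabs_pos_eq (exp _)) by (left; apply exp_pos).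
    assert (Hs : Rabs (sin (INR (S k) * x)) <= 1) by (apply Rabs_le; apply SIN_bound).
    assert (He : exp (INR (S k) * t) <= exp (INR (S p) * t)).
    { apply exp_le_compat, Rmult_le_compat_r; [easy|]. apply le_INR. lia. }
    assert (He0 := exp_pos (INR (S k) * t)).
    assert (Hs0 := Rabs_pos (sin (INR (S k) * x))). assert (Hc0 := Rabs_pos (c k)).
    rewrite Rmult_assoc. apply Rmult_le_compat_l; [easy|]. nra.
  - apply Rle_trans with (eta * exp (INR (S p) * t)).
    + apply Rmult_le_compat_r; [left; apply exp_pos|easy].
    + unfold eta. rewrite <- exp_plus, Rplus_opp_l, exp_0. lra. }
specialize (HT1 T ltac:(lra)). rewrite Rmult_assoc, <- exp_plus in HT1.
replace (INR (S (S p)) * t + - (1 * T)) with (INR (S (S p)) * t - T) in HT1 by ring.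
assert (E * (1 + m) * exp (al * t) <= 2 * E * exp (al * t)) by (apply Rmult_le_compat_r; nra).
apply Rabs_le_between in Hc. apply Rabs_le_between in Hmodes. apply Rabs_le. lra.
Qed.

(** * From the sector to the half-strip *)

Lemma sup_on_lt_p_infty (D : C -> Prop) (f : C -> R) :
  Rbar_lt (sup_on D f) p_infty <-> exists M, forall z, D z -> f z <= M.
Proof.
unfold sup_on. set (E := fun t => exists z, D z /\ t = f z).
destruct (Lub_Rbar_correct E) as [Hub Hlub]. split.
- intros H. destruct (Lub_Rbar E) as [M| |] eqn:EL; [|easy|].
  + exists M. intros z Hz. apply (Hub (f z)). now exists z.
  + exists 0. intros z Hz. elim (Hub (f z)). now exists z.
- intros [M HM]. apply Rbar_le_lt_trans with (Finite M); [|easy].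
  apply Hlub. intros t [z [Hz ->]]. now apply HM.
Qed.

Lemma sector_iff rho a b : 0 < rho ->
  sector rho (a, b) <-> 0 < a /\ 0 < b /\ a ^ 2 + b ^ 2 < rho ^ 2.
Proof.
intros Hrho.
assert (Hmod : Cmod (a, b) < rho <-> a ^ 2 + b ^ 2 < rho ^ 2).
{ unfold Cmod. simpl fst; simpl snd.
  assert (H0 : 0 <= a ^ 2 + b ^ 2) by (assert (H1 := pow2_ge_0 a); assert (H2 := pow2_ge_0 b); lra).
  rewrite <- (sqrt_pow2 rho) at 1 by lra. split; intros H.
  - apply sqrt_lt_0_alt in H. exact H.
  - apply sqrt_lt_1_alt. lra. }
rewrite <- Hmod. unfold sector. split.
- intros [Hz [HA Hm]]. destruct (Carg_spec (a, b) Hz) as [_ E].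
  assert (Hp : 0 < Cmod (a, b)) by now apply Cmod_gt_0.
  injection E as Ea Eb.
  split; [rewrite Ea|split; [rewrite Eb|easy]]; apply Rmult_lt_0_compat; try easy.
  + apply cos_gt_0; lra.
  + apply sin_gt_0; lra.
- intros [Ha [Hb Hm]].
  assert (Hz : ((a, b) : C) <> 0%C) by (intros E; injection E; lra).
  split; [easy|]. split; [|easy].
  assert (Hp : 0 < Cmod (a, b)) by now apply Cmod_gt_0.
  destruct (Carg_spec (a, b) Hz) as [HA E]. injection E as Ea Eb.
  split; apply Rnot_le_lt; intros Hle.
  + assert (sin (Carg (a, b)) <= 0).
    { destruct (Rle_lt_or_eq_dec _ _ Hle) as [Hlt|Heq]; [|rewrite Heq, sin_0; lra].
      left. apply sin_lt_0_var; lra. }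
    nra.
  + assert (cos (Carg (a, b)) <= 0).
    { apply cos_le_0; lra. }
    nra.
Qed.

Lemma sector_open rho a b : 0 < rho -> sector rho (a, b) ->
  locally_2d (fun a' b' => sector rho (a', b')) a b.
Proof.
intros Hrho H. apply sector_iff in H; [|easy]. destruct H as [Ha [Hb Hm]].
assert (Hc : continuity_2d_pt (fun a b => a ^ 2 + b ^ 2) a b).
{ apply continuity_2d_pt_plus.
  - apply (continuity_1d_2d_pt_comp (fun a => a ^ 2) (fun a _ => a)); [|apply continuity_2d_pt_id1].
    apply continuity_pt_filterlim. apply (ex_derive_continuous (fun a => a ^ 2)). now auto_derive.
  - apply (continuity_1d_2d_pt_comp (fun b => b ^ 2) (fun _ b => b)); [|apply continuity_2d_pt_id2].
    apply continuity_pt_filterlim. apply (ex_derive_continuous (fun b => b ^ 2)). now auto_derive. }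
assert (Heps : 0 < rho ^ 2 - (a ^ 2 + b ^ 2)) by lra.
destruct (Hc (mkposreal _ Heps)) as [d Hd]. simpl pos in Hd.
assert (Hm0 : 0 < Rmin d (Rmin a b)).
{ assert (H := cond_pos d). unfold Rmin; repeat destruct Rle_dec; lra. }
exists (mkposreal _ Hm0). simpl. intros a' b' Ha' Hb'.
assert (G1 := Rmin_l d (Rmin a b)). assert (G2 := Rmin_r d (Rmin a b)).
assert (G3 := Rmin_l a b). assert (G4 := Rmin_r a b).
specialize (Hd a' b' ltac:(lra) ltac:(lra)).
apply Rabs_def2 in Hd. apply Rabs_def2 in Ha'. apply Rabs_def2 in Hb'.
apply sector_iff; [easy|]. lra.
Qed.

(** Pulling the point slightly towards the bisector and towards 0 moves it into
    the open sector. *)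
Lemma punctured_closed_sector_intro rho a b : 0 < rho -> 0 <= a -> 0 <= b ->
  0 < a ^ 2 + b ^ 2 <= rho ^ 2 -> punctured_closed_sector rho (a, b).
Proof.
intros Hrho Ha Hb Hm. split.
- intros P [d Hd].
  set (r := sqrt (a ^ 2 + b ^ 2)).
  assert (Hr2 : r ^ 2 = a ^ 2 + b ^ 2) by (unfold r; rewrite pow2_sqrt; lra).
  assert (Hr : 0 < r) by (apply sqrt_lt_R0; lra).
  assert (Har : a <= r) by (apply Rnot_lt_le; intros H; nra).
  assert (Hbr : b <= r) by (apply Rnot_lt_le; intros H; nra).
  assert (Hd0 := cond_pos d).
  assert (Hq : 0 < d / (4 * r)) by (apply Rdiv_lt_0_compat; lra).
  set (e := Rmin (/ 4) (d / (4 * r))).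
  assert (He : 0 < e <= / 4) by (unfold e, Rmin; destruct Rle_dec; lra).
  assert (Her : 4 * r * e <= d).
  { replace (pos d) with (4 * r * (d / (4 * r))) by (field; lra).
    apply Rmult_le_compat_l; [lra|apply Rmin_r]. }
  set (a' := (1 - 2 * e) * a + e * (r / 2)). set (b' := (1 - 2 * e) * b + e * (r / 2)).
  exists (a', b'). split.
  + apply Hd. assert (0 <= e * r) by nra. assert (0 <= e * a <= e * r) by nra.
    assert (0 <= e * b <= e * r) by nra.
    split; [change (Rabs (a' - a) < d)|change (Rabs (b' - b) < d)];
      apply Rabs_def1; unfold a', b'; nra.
  + apply sector_iff; [easy|].
    assert (0 < e * (r / 2)) by nra. assert (0 <= (1 - 2 * e) * a) by nra. assert (0 <= (1 - 2 * e) * b) by nra.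
    unfold a', b'. split; [lra|]. split; [lra|].
    replace (((1 - 2 * e) * a + e * (r / 2)) ^ 2 + ((1 - 2 * e) * b + e * (r / 2)) ^ 2)
      with ((1 - 2 * e) ^ 2 * (a ^ 2 + b ^ 2) + (1 - 2 * e) * e * r * (a + b) + e ^ 2 * r ^ 2 / 2) by field.
    rewrite <- Hr2.
    assert ((1 - 2 * e) * e * r * (a + b) <= (1 - 2 * e) * e * r * (2 * r)).
    { apply Rmult_le_compat_l; [|lra]. repeat apply Rmult_le_pos; lra. }
    assert (Hfin : 0 < r ^ 2 * (e * (2 - e / 2))) by (repeat apply Rmult_lt_0_compat; nra).
    nra.
- intros E. injection E as -> ->. lra.
Qed.

Lemma is_derive_comp_2d (f : R -> R -> R) (X Y : R -> R) (t X1 Y1 : R) :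
  locally_2d (ex_diff_n f 1) (X t) (Y t) ->
  is_derive X t X1 -> is_derive Y t Y1 ->
  is_derive (fun s => f (X s) (Y s)) t
    (Derive (fun z => f z (Y t)) (X t) * X1 + Derive (fun z => f (X t) z) (Y t) * Y1).
Proof.
intros Hf HX HY.
assert (Hf0 := locally_2d_singleton _ _ _ Hf). destruct Hf0 as [_ [_ [Hy [[Hc _] _]]]].
set (d1 := Derive (fun z => f z (Y t)) (X t)). set (d2 := Derive (fun z => f (X t) z) (Y t)).
apply filterdiff_ext_lin with (fun y : R => plus (scal (scal y X1) d1) (scal (scal y Y1) d2)).
- apply (filterdiff_comp'_2 X Y f t (fun y => scal y X1) (fun y => scal y Y1)
    (fun a b => plus (scal a d1) (scal b d2)) HX HY).
  apply (is_derive_filterdiff f (X t) (Y t) (fun a b => Derive (fun z => f z b) a) d2).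
  + apply (proj1 (locally_2d_locally
      (fun a b => is_derive (fun z => f z b) a (Derive (fun z => f z b) a)) (X t) (Y t))).
    revert Hf. apply locally_2d_impl. apply locally_2d_forall.
    intros a b [_ [Hx _]]. now apply Derive_correct.
  + now apply Derive_correct.
  + apply continuity_2d_pt_filterlim in Hc. exact Hc.
- intros y. change (y * X1 * d1 + y * Y1 * d2 = y * (d1 * X1 + d2 * Y1)). ring.
Qed.

(** The chain rule to second order along a curve. The two mixed derivatives
    are kept apart: in the Laplacian in polar coordinates their coefficients
    cancel. *)
Lemma is_second_derive_comp_2d (f : R -> R -> R) (X Y X1 Y1 : R -> R) (t X2 Y2 : R) :
  locally_2d (ex_diff_n f 2) (X t) (Y t) ->
  (forall s, is_derive X s (X1 s)) -> (forall s, is_derive Y s (Y1 s)) ->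
  is_derive X1 t X2 -> is_derive Y1 t Y2 ->
  let fx := fun a b => Derive (fun z => f z b) a in
  let fy := fun a b => Derive (fun z => f a z) b in
  let at_t := fun g : R -> R -> R => g (X t) (Y t) in
  is_second_derive (fun s => f (X s) (Y s)) t
    ((at_t (fun a b => Derive (fun z => fx z b) a) * X1 t
      + at_t (fun a b => Derive (fun z => fx a z) b) * Y1 t) * X1 t + at_t fx * X2
     + ((at_t (fun a b => Derive (fun z => fy z b) a) * X1 t
      + at_t (fun a b => Derive (fun z => fy a z) b) * Y1 t) * Y1 t + at_t fy * Y2)).
Proof.
intros Hf HX HY HX1 HY1 fx fy at_t.
exists (fun s => fx (X s) (Y s) * X1 s + fy (X s) (Y s) * Y1 s). split.
- assert (Hnear : locally t (fun s => locally_2d (ex_diff_n f 2) (X s) (Y s))).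
  { apply locally_2d_locally in Hf.
    assert (Hl := locally_locally _ _ Hf).
    assert (HcX : continuous X t) by (apply (ex_derive_continuous (V := R_NormedModule) X); eexists; apply HX).
    assert (HcY : continuous Y t) by (apply (ex_derive_continuous (V := R_NormedModule) Y); eexists; apply HY).
    assert (HcXY : filterlim (fun s => (X s, Y s)) (locally t) (locally (X t, Y t))).
    { apply filterlim_locally. intros e.
      assert (G1 := proj1 (filterlim_locally _ _) HcX e). assert (G2 := proj1 (filterlim_locally _ _) HcY e).
      generalize (filter_and _ _ G1 G2). apply filter_imp. intros s [K1 K2]. split; easy. }
    specialize (HcXY _ Hl). unfold filtermap in HcXY. revert HcXY. apply filter_imp. intros s Hs.
    apply (proj2 (locally_2d_locally (ex_diff_n f 2) (X s) (Y s))). exact Hs. }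
  revert Hnear. apply filter_imp. intros s Hs. apply is_derive_comp_2d; [|easy|easy].
  revert Hs. apply locally_2d_impl, locally_2d_forall. intros a b. apply ex_diff_n_m. lia.
- assert (Hfx : locally_2d (ex_diff_n fx 1) (X t) (Y t)).
  { revert Hf. apply locally_2d_impl, locally_2d_forall. intros a b. apply (ex_diff_n_deriv_aux1 f 1). }
  assert (Hfy : locally_2d (ex_diff_n fy 1) (X t) (Y t)).
  { revert Hf. apply locally_2d_impl, locally_2d_forall. intros a b. apply (ex_diff_n_deriv_aux2 f 1). }
  assert (Dx := is_derive_comp_2d fx X Y t _ _ Hfx (HX t) (HY t)).
  assert (Dy := is_derive_comp_2d fy X Y t _ _ Hfy (HX t) (HY t)).
  apply (is_derive_plus (fun s => fx (X s) (Y s) * X1 s) (fun s => fy (X s) (Y s) * Y1 s)).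
  + apply (is_derive_mult (fun s => fx (X s) (Y s)) X1 t _ _ Dx HX1). intros; apply Rmult_comm.
  + apply (is_derive_mult (fun s => fy (X s) (Y s)) Y1 t _ _ Dy HY1). intros; apply Rmult_comm.
Qed.

(** The halves turn the quarter-disc into a half-strip of width [PI], on which
    the modes are [sin x], [sin 2x], and so on. *)
Definition polar_x (rho t x : R) : R := rho * exp (- (t / 2)) * cos (x / 2).
Definition polar_y (rho t x : R) : R := rho * exp (- (t / 2)) * sin (x / 2).

Lemma polar_derive_t rho t x :
  is_derive (fun s => polar_x rho s x) t (- / 2 * polar_x rho t x) /\
  is_derive (fun s => polar_y rho s x) t (- / 2 * polar_y rho t x).
Proof.
unfold polar_x, polar_y. split; (auto_derive; [easy|unfold Rdiv; ring]).
Qed.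

Lemma polar_derive_x rho t x :
  is_derive (fun y => polar_x rho t y) x (- / 2 * polar_y rho t x) /\
  is_derive (fun y => polar_y rho t y) x (/ 2 * polar_x rho t x).
Proof.
unfold polar_x, polar_y. split; (auto_derive; [easy|unfold Rdiv; ring]).
Qed.

Lemma polar_norm rho t x : polar_x rho t x ^ 2 + polar_y rho t x ^ 2 = (rho * exp (- (t / 2))) ^ 2.
Proof.
unfold polar_x, polar_y. assert (H := sin2_cos2 (x / 2)). unfold Rsqr in H.
rewrite !Rpow_mult_distr. replace (cos (x / 2) ^ 2) with (1 - sin (x / 2) ^ 2) by nra. ring.
Qed.

Lemma polar_sector rho t x : 0 < rho -> 0 < t -> 0 < x < PI ->
  sector rho (polar_x rho t x, polar_y rho t x).
Proof.
intros Hrho Ht Hx. apply sector_iff; [easy|]. rewrite polar_norm.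
assert (He := exp_pos (- (t / 2))).
assert (He1 : exp (- (t / 2)) < 1) by (rewrite <- exp_0; apply exp_increasing; lra).
unfold polar_x, polar_y. split; [|split].
- apply Rmult_lt_0_compat; [nra|]. apply cos_gt_0; lra.
- apply Rmult_lt_0_compat; [nra|]. apply sin_gt_0; lra.
- assert (0 < rho * exp (- (t / 2)) < rho) by nra. nra.
Qed.

Lemma polar_closed_sector rho t x : 0 < rho -> 0 <= t -> 0 <= x <= PI ->
  punctured_closed_sector rho (polar_x rho t x, polar_y rho t x).
Proof.
intros Hrho Ht Hx.
assert (He := exp_pos (- (t / 2))).
assert (He1 : exp (- (t / 2)) <= 1) by (rewrite <- exp_0; apply exp_le_compat; lra).
apply punctured_closed_sector_intro; [easy| | |].
- apply Rmult_le_pos; [nra|]. apply cos_ge_0; lra.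
- apply Rmult_le_pos; [nra|]. apply sin_ge_0; lra.
- rewrite polar_norm. assert (0 < rho * exp (- (t / 2)) <= rho) by nra. nra.
Qed.

Lemma polar_Cmod rho t x : 0 < rho ->
  Cmod (polar_x rho t x, polar_y rho t x) = rho * exp (- (t / 2)).
Proof.
intros Hrho. unfold Cmod. simpl fst; simpl snd. rewrite polar_norm. apply sqrt_pow2.
assert (He := exp_pos (- (t / 2))). nra.
Qed.

Lemma polar_Carg rho t x : 0 < rho -> 0 <= x <= PI ->
  Carg (polar_x rho t x, polar_y rho t x) = x / 2.
Proof.
intros Hrho Hx. unfold Carg. rewrite polar_Cmod by easy.
assert (He := exp_pos (- (t / 2))).
assert (Hy : 0 <= polar_y rho t x).
{ apply Rmult_le_pos; [nra|]. apply sin_ge_0; lra. }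
change (Im (polar_x rho t x, polar_y rho t x)) with (polar_y rho t x).
change (Re (polar_x rho t x, polar_y rho t x)) with (polar_x rho t x).
destruct Rle_dec; [|easy]. unfold polar_x.
replace (rho * exp (- (t / 2)) * cos (x / 2) / (rho * exp (- (t / 2)))) with (cos (x / 2)) by (field; lra).
apply acos_cos. lra.
Qed.

Definition in_strip (u : C -> R) (rho t x : R) : R := u (polar_x rho t x, polar_y rho t x).

Lemma in_strip_continuous rho u : 0 < rho ->
  continuous_on (punctured_closed_sector rho) u -> strip_continuous (in_strip u rho).
Proof.
intros Hrho Hu t x Ht Hx eps He.
assert (Hz := polar_closed_sector rho t x Hrho Ht Hx).
specialize (Hu _ Hz).
assert (HP := proj1 (filterlim_locally _ _) Hu (mkposreal eps He)).
destruct HP as [d Hd].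
assert (HcX : continuity_2d_pt (polar_x rho) t x).
{ apply (continuity_2d_pt_product (fun t => rho * exp (- (t / 2))) (fun x => cos (x / 2)));
  intros y; now auto_derive. }
assert (HcY : continuity_2d_pt (polar_y rho) t x).
{ apply (continuity_2d_pt_product (fun t => rho * exp (- (t / 2))) (fun x => sin (x / 2)));
  intros y; now auto_derive. }
destruct (HcX d) as [d1 H1]. destruct (HcY d) as [d2 H2].
exists (Rmin d1 d2). split; [apply Rmin_pos; apply cond_pos|].
intros t' x' Ht' Hx' Hdt Hdx.
assert (G1 := Rmin_l d1 d2). assert (G2 := Rmin_r d1 d2).
apply (Hd (polar_x rho t' x', polar_y rho t' x')).
- split; [apply (H1 t' x')|apply (H2 t' x')]; lra.
- now apply polar_closed_sector.
Qed.

(** The change of variables is conformal: the Laplacian of the composite is the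
    Laplacian of [u] times [|z|^2/4]. *)
Lemma in_strip_harmonic rho u : 0 < rho ->
  harmonic_on (sector rho) u -> strip_harmonic (in_strip u rho).
Proof.
intros Hrho Hu t x Ht Hx.
assert (Hz := polar_sector rho t x Hrho Ht Hx).
set (f := fun a b : R => u (a, b)).
assert (Hf : locally_2d (ex_diff_n f 2) (polar_x rho t x) (polar_y rho t x)).
{ generalize (sector_open _ _ _ Hrho Hz). apply locally_2d_impl, locally_2d_forall.
  intros a b Hab. apply (Hu _ Hab). }
destruct (Hu _ Hz) as [_ Hlap].
change (partial_derive 2 0 f (polar_x rho t x) (polar_y rho t x)
  + partial_derive 0 2 f (polar_x rho t x) (polar_y rho t x) = 0) in Hlap.
unfold partial_derive in Hlap. simpl Derive_n in Hlap.
set (X := polar_x rho t x) in *. set (Y := polar_y rho t x) in *.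
eexists; eexists; split; [|split].
- apply (is_second_derive_comp_2d f (fun s => polar_x rho s x) (fun s => polar_y rho s x)
    (fun s => - / 2 * polar_x rho s x) (fun s => - / 2 * polar_y rho s x) t
    (- / 2 * (- / 2 * X)) (- / 2 * (- / 2 * Y)) Hf); intros.
  + apply polar_derive_t.
  + apply polar_derive_t.
  + apply is_derive_scal, polar_derive_t.
  + apply is_derive_scal, polar_derive_t.
- apply (is_second_derive_comp_2d f (fun y => polar_x rho t y) (fun y => polar_y rho t y)
    (fun y => - / 2 * polar_y rho t y) (fun y => / 2 * polar_x rho t y) x
    (- / 2 * (/ 2 * X)) (/ 2 * (- / 2 * Y)) Hf); intros.
  + apply polar_derive_x.
  + apply polar_derive_x.
  + apply is_derive_scal, polar_derive_x.
  + apply is_derive_scal, polar_derive_x.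
- cbv beta zeta. fold X Y.
set (fxx := Derive (fun z => Derive (fun w => f w Y) z) X) in *.
set (fyy := Derive (fun z => Derive (fun w => f X w) z) Y) in *.
replace fyy with (- fxx) by (unfold fyy, fxx in *; lra). field.
Qed.

Lemma sin_ge_third a : 0 <= a <= PI / 2 -> a / 3 <= sin a.
Proof.
intros Ha. assert (Hpi := PI_4).
destruct (pre_sin_bound a 0) as [H _]; [lra|lra|].
apply Rle_trans with (2 := H). unfold sin_approx, sin_term. simpl. field_simplify. nra.
Qed.

(** A zero would be a multiple of [PI], making [theta/PI] a fraction of
    denominator [2(k+1)]. *)
Lemma irrational_sin_nonzero theta k : irrational (theta / PI) -> sin (INR (S k) * (2 * theta)) <> 0.
Proof.
intros Hirr Hs. apply Hirr. destruct (sin_eq_0_0 _ Hs) as [z Hz].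
set (d := Pos.of_nat (2 * S k)).
assert (Hden : IZR (Z.pos d) = 2 * INR (S k)).
{ replace (Z.pos d) with (Z.of_nat (2 * S k)) by (unfold d; lia).
  rewrite <- INR_IZR_INZ, mult_INR. simpl INR at 1. ring. }
exists (Qmake z d). unfold Q2R, Qnum, Qden.
rewrite Hden. assert (Hp := PI_RGT_0). assert (Hk := pos_INR k). rewrite S_INR in *.
replace (IZR z) with ((INR k + 1) * (2 * theta) / PI) by (rewrite Hz; field; lra).
field. lra.
Qed.

Theorem proposition2p4 :
  forall (rho : R) (u : C -> R),
    0 < rho ->
    harmonic_on (sector rho) u ->
    continuous_on (punctured_closed_sector rho) u ->
    forall l theta : R,
      0 <= l < 2 ->
      0 < theta < PI / 2 ->
      irrational (theta / PI) ->
      Rbar_lt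
        (sup_on
           (fun z => punctured_closed_sector rho z /\
                     (Carg z = 0 \/ Carg z = theta \/ Carg z = PI / 2))
           (fun z => Rpower (Cmod z) l * Rabs (u z)))
        p_infty ->
      (exists m : R, 0 <= m /\
        Rbar_lt
          (sup_on (sector rho) (fun z => Rpower (Rabs (Im z)) m * Rabs (u z)))
          p_infty) ->
      Rbar_lt
        (sup_on (sector rho) (fun z => Rpower (Cmod z) l * Rabs (u z)))
        p_infty.
Proof.
intros rho u Hrho Hharm Hcont l theta Hl Htheta Hirr Hrays [m [Hm Hint]].
apply sup_on_lt_p_infty in Hrays. destruct Hrays as [M1 HM1].
apply sup_on_lt_p_infty in Hint. destruct Hint as [M2 HM2].
apply sup_on_lt_p_infty.
assert (HPI := PI_RGT_0).
assert (Hpow : forall t q, Rpower (rho * exp (- (t / 2))) q = Rpower rho q * exp (- (q / 2 * t))).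
{ intros t q. unfold Rpower. rewrite ln_mult, ln_exp, <- exp_plus; [|easy|apply exp_pos].
  f_equal. field. }
assert (Hpos : forall x y, 0 < Rpower x y) by (intros; apply exp_pos).
destruct (INR_unbounded m) as [n0 Hn0]. set (n := S n0).
assert (Hn : m <= INR n) by (unfold n; rewrite S_INR; lra).
set (C1 := (Rabs M1 + 1) / Rpower rho l).
set (C2 := 6 ^ n * ((Rabs M2 + 1) / Rpower rho m)).
assert (HC1 : 0 < C1).
{ apply Rdiv_lt_0_compat; [|apply Hpos]. assert (H := Rabs_pos M1). lra. }
assert (HC2 : 0 < C2).
{ apply Rmult_lt_0_compat; [apply pow_lt; lra|]. apply Rdiv_lt_0_compat; [|apply Hpos].
  assert (H := Rabs_pos M2). lra. }
destruct (half_strip_bound (in_strip u rho) n (2 * theta) (l / 2) C1 C2) as [E HE]; try easy; try lra.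
- unfold n; lia.
- intros k. now apply irrational_sin_nonzero.
- now apply in_strip_continuous.
- now apply in_strip_harmonic.
- intros t x Ht Hx.
  assert (Hx' : 0 <= x <= PI) by (destruct Hx as [->|[->| ->]]; lra).
  specialize (HM1 (polar_x rho t x, polar_y rho t x)).
  rewrite polar_Carg, polar_Cmod, Hpow in HM1 by easy.
  assert (HM : Rpower rho l * exp (- (l / 2 * t)) * Rabs (in_strip u rho t x) <= M1).
  { apply HM1. split; [now apply polar_closed_sector|]. destruct Hx as [->|[->| ->]]; lra. }
  assert (HMa := Rle_abs M1).
  apply Rmult_le_reg_l with (Rpower rho l * exp (- (l / 2 * t))).
  { apply Rmult_lt_0_compat; [apply Hpos|apply exp_pos]. }
  replace (Rpower rho l * exp (- (l / 2 * t)) * (C1 * exp (l / 2 * t))) with (Rabs M1 + 1); [lra|].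
  rewrite exp_Ropp. unfold C1. field. split; apply Rgt_not_eq; [apply Hpos|apply exp_pos].
- intros t x Ht Hx.
  specialize (HM2 _ (polar_sector rho t x Hrho Ht Hx)).
  change (Im (polar_x rho t x, polar_y rho t x)) with (polar_y rho t x) in HM2.
  change (u (polar_x rho t x, polar_y rho t x)) with (in_strip u rho t x) in HM2.
  set (v := Rabs (in_strip u rho t x)) in *. assert (Hv : 0 <= v) by apply Rabs_pos.
  assert (He := exp_pos (- (t / 2))).
  assert (Hsin : x / 6 <= sin (x / 2)).
  { assert (H := sin_ge_third (x / 2) ltac:(lra)). lra. }
  assert (Hy : polar_y rho t x = rho * exp (- (t / 2)) * sin (x / 2)) by reflexivity.
  assert (H0 : 0 < rho * exp (- (t / 2))) by now apply Rmult_lt_0_compat.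
  rewrite Rabs_pos_eq in HM2 by (rewrite Hy; apply Rmult_le_pos; lra).
  rewrite Hy, <- Rpower_mult_distr, Hpow in HM2 by lra.
  (* x/6 < 1, so enlarging the exponent only weakens the bound *)
  assert (Hx6 : (x / 6) ^ n <= Rpower (sin (x / 2)) m).
  { rewrite <- Rpower_pow by lra. apply Rle_trans with (Rpower (x / 6) m).
    - unfold Rpower. apply exp_le_compat. assert (Hp4 := PI_4).
      assert (ln (x / 6) < 0) by (rewrite <- ln_1; apply ln_increasing; lra). nra.
    - apply Rle_Rpower_l; lra. }
  assert (Hexp : exp (m / 2 * t) <= exp (INR n * t)) by (apply exp_le_compat; nra).
  assert (HMa := Rle_abs M2). assert (HMb := Rabs_pos M2).
  assert (Hq : (x / 6) ^ n * v <= (Rabs M2 + 1) / Rpower rho m * exp (m / 2 * t)).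
  { apply Rle_trans with (Rpower (sin (x / 2)) m * v); [now apply Rmult_le_compat_r|].
    apply Rmult_le_reg_l with (Rpower rho m * exp (- (m / 2 * t))).
    { apply Rmult_lt_0_compat; [apply Hpos|apply exp_pos]. }
    replace (Rpower rho m * exp (- (m / 2 * t)) * ((Rabs M2 + 1) / Rpower rho m * exp (m / 2 * t)))
      with (Rabs M2 + 1); [lra|].
    rewrite exp_Ropp. field. split; apply Rgt_not_eq; [apply Hpos|apply exp_pos]. }
  replace (x ^ n) with (6 ^ n * (x / 6) ^ n) by (rewrite <- Rpow_mult_distr; f_equal; field).
  unfold C2. rewrite !Rmult_assoc. apply Rmult_le_compat_l; [apply pow_le; lra|].
  apply Rle_trans with (1 := Hq). apply Rmult_le_compat_l; [|easy].
  left. apply Rdiv_lt_0_compat; [lra|apply Hpos].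
- exists (Rpower rho l * E). intros z Hz.
  pose proof Hz as [Hz0 [HA Hmod]]. destruct (Carg_spec z Hz0) as [_ Ez].
  assert (Hzp : 0 < Cmod z) by now apply Cmod_gt_0.
  set (t := - (2 * ln (Cmod z / rho))). set (x := 2 * Carg z).
  assert (Hr : rho * exp (- (t / 2)) = Cmod z).
  { unfold t. replace (- (- (2 * ln (Cmod z / rho)) / 2)) with (ln (Cmod z / rho)) by field.
    rewrite exp_ln by now apply Rdiv_lt_0_compat. field. lra. }
  assert (Ht : 0 <= t).
  { unfold t. assert (ln (Cmod z / rho) < 0); [|lra]. rewrite <- ln_1. apply ln_increasing.
    - now apply Rdiv_lt_0_compat.
    - apply Rmult_lt_reg_r with rho; [easy|]. replace (Cmod z / rho * rho) with (Cmod z) by (field; lra). lra. }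
  specialize (HE t x Ht ltac:(unfold x; lra)).
  assert (Hu : in_strip u rho t x = u z).
  { unfold in_strip, polar_x, polar_y. rewrite Hr. unfold x.
    replace (2 * Carg z / 2) with (Carg z) by field. now rewrite <- Ez. }
  rewrite Hu in HE. rewrite <- Hr, Hpow.
  apply Rmult_le_compat_l with (r := Rpower rho l * exp (- (l / 2 * t))) in HE.
  + apply Rle_trans with (1 := HE). right. rewrite exp_Ropp. field. apply Rgt_not_eq, exp_pos.
  + left. apply Rmult_lt_0_compat; [apply Hpos|apply exp_pos].
Qed.
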